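(* Let $d\ge 1$ and let $\Lambda$ be a locally square-integrable invariant (simple) point process in $\mathbb{R}^d$ with centered diffraction $\widehat{\eta}_\Lambda$. Let $B_R\subset\mathbb{R}^d$ denote the Euclidean ball of radius $R$ around $0$. Then $\Lambda$ is geometrically hyperuniform, i.e. the limit $$\lim_{R\to\infty}\frac{\mathrm{Var}(\#(\Lambda\cap B_R))}{\mathrm{Vol}_d(B_R)}$$ exists and is equal to $0$, if and only if $\Lambda$ is spectrally hyperuniform, i.e. $$\lim_{\varepsilon\to 0}\frac{\widehat{\eta}_\Lambda(B_\varepsilon)}{\mathrm{Vol}_d(B_\varepsilon)}=0.$$
   Context: An invariant simple point process in $\mathbb{R}^d$ is an $\mathbb{R}^d$-equivariant measurable map $\omega\mapsto\Lambda_\omega$ from a standard probability space $(\Omega,\mathbb{P})$ with a probability-measure-preserving $\mathbb{R}^d$-action to the locally finite subsets of $\mathbb{R}^d$ (identified with the measures $\delta_{\Lambda_\omega}=\sum_{x\in\Lambda_\omega}\delta_x$, on which $\mathbb{R}^d$ acts by translations). It is locally square-integrable if $\mathbb{E}[\#(\Lambda\cap B)^2]<\infty$ for every bounded Borel set $B$. For a bounded Borel function $f$ with bounded support put $\mathcal{P}_\Lambda f(\omega)=\sum_{x\in\Lambda_\omega}f(x)$. There is a unique signed Radon measure $\eta_\Lambda$ on $\mathbb{R}^d$ with $\eta_\Lambda(f*f^* )=\mathrm{Var}(\mathcal{P}_\Lambda f)$ for all such $f$, where $f^*(x)=\overline{f(-x)}$; it is positive-definite, and the centered diffraction $\widehat{\eta}_\Lambda$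 is its Fourier transform, a positive Radon measure on $\mathbb{R}^d$. It satisfies $\int|\widehat f|^2\,d\widehat{\eta}_\Lambda=\mathrm{Var}(\mathcal{P}_\Lambda f)$, where $\widehat f(\xi)=\int f(x)e^{-2\pi i\langle x,\xi\rangle}\,dx$. *)

(* Defs.v *)
From HB Require Import structures.
From mathcomp Require Import all_boot all_order all_algebra.
From mathcomp Require Import all_classical all_reals all_analysis.
From mathcomp Require Import measurable_realfun complex.
Set Implicit Arguments.
Unset Strict Implicit.
Unset Printing Implicit Defensive.
Import Order.TTheory GRing.Theory Num.Theory.
Import numFieldNormedType.Exports.
Local Open Scope classical_set_scope.
Local Open Scope ring_scope.

HB.instance Definition _ (R : realType) (m n : nat) :=
  @isMeasurable.Build (sigma_display (@open 'M[R]_(m, n))) 'M[R]_(m, n)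
    <<s @open 'M[R]_(m, n) >> (@sigma_algebra0 _ setT _)
    (@sigma_algebraC _ _) (@sigma_algebra_bigcup _ setT _).

Section borel_mx.
Context {R : realType} {m n : nat}.

Lemma open_measurable_mx (U : set 'M[R]_(m, n)) : open U -> measurable U.
Proof. exact: sub_sigma_algebra. Qed.

Lemma measurable_coord (i : 'I_m) (j : 'I_n) :
  measurable_fun setT (fun M : 'M[R]_(m, n) => M i j).
Proof.
apply: (measurability _ (RGenOpens.measurableE R)) => //.
move=> _ [_ [a [b ->] <-]]; rewrite setTI.
apply: open_measurable_mx.
apply: open_comp; last exact: interval_open.
by move=> M _; exact: coord_continuous.
Qed.

Lemma measurable_fun_mx d (T : measurableType d) (f : T -> 'M[R]_(m, n)) :
  (forall i j, measurable_fun setT (fun x => f x i j)) ->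
  measurable_fun setT f.
Proof.
move=> mf; apply: (measurability (@open 'M[R]_(m, n))) => //.
move=> _ [U oU <-]; rewrite setTI.
pose B (q : 'M[rat]_(m, n)) (k : nat) : set 'M[R]_(m, n) :=
  [set M | forall i j, `|ratr (q i j) - M i j| < k.+1%:R^-1].
have mB q k : measurable (f @^-1` B q k).
  rewrite (_ : _ @^-1` _ = \bigcap_(i in [set: 'I_m]) \bigcap_(j in [set: 'I_n])
    ((fun x => f x i j) @^-1` ball (ratr (q i j) : R) k.+1%:R^-1)).
    apply: fin_bigcap_measurable => // i _.
    apply: fin_bigcap_measurable => // j _.
    rewrite -[X in measurable X]setTI; apply: mf => //.
    by apply: open_measurable; apply: ball_open; rewrite invr_gt0.
  by apply/seteqP; split=> x /= h i; [move=> _ j _; exact: h|move=> j; exact: h].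
pose F N : set T := if (unpickle N : option ('M[rat]_(m, n) * nat)) is Some (q, k) then
  (if `[< B q k `<=` U >] then f @^-1` B q k else set0) else set0.
rewrite (_ : _ @^-1` U = \bigcup_N F N); last first.
  apply/seteqP; split=> [x /= Ux|x [N _]]; last first.
    rewrite /F; case: unpickle => [[q k]|//].
    by case: ifPn => // /asboolP BU Bx; exact: BU.
  have /nbhs_ballP[e /= e0 eU] : nbhs (f x) U by exact: open_nbhs_nbhs.
  have [k ke] : exists k : nat, k.+1%:R^-1 < e / 2.
    have e2 : 0 < e / 2 by rewrite divr_gt0.
    by near \oo => k; exists k; near: k; exact: (near_infty_natSinv_lt (PosNum e2)).
  have k0 : 0 < (k.+1%:R^-1 : R) by rewrite invr_gt0.
  have /choice[q qP] : forall i, exists q : 'I_n -> rat,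
      forall j, `|ratr (q j) - f x i j| < k.+1%:R^-1.
    move=> i.
    have : forall j, exists q : rat, `|ratr q - f x i j| < k.+1%:R^-1.
      move=> j.
      have : f x i j - k.+1%:R^-1 < f x i j + k.+1%:R^-1.
        by rewrite ltrD2l (lt_trans _ k0)// oppr_lt0.
      move=> /rat_in_itvoo[r]; rewrite in_itv/= => /andP[r1 r2].
      by exists r; rewrite ltr_distl r1.
    by move=> /choice[r rP]; exists r.
  exists (pickle (\matrix_(i, j) q i j, k)) => //.
  rewrite /F pickleK ifT//; first by move=> i j; rewrite mxE.
  apply/asboolP => M MB; apply: eU; split => // i j.
  rewrite /ball/= (le_lt_trans (ler_distD (ratr (q i j)) _ _))//.
  rewrite [e]splitr ltrD//; first by rewrite distrC (lt_trans (qP _ _)).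
  by have := MB i j; rewrite mxE => /lt_trans; exact.
apply: bigcupT_measurable => N; rewrite /F; case: unpickle => [[q k]|//].
by case: ifPn.
Unshelve. all: by end_near. Qed.

End borel_mx.

Section lebesgue_rV.
Context {R : realType}.

Definition rV_cons (d : nat) (p : R * 'rV[R]_d) : 'rV[R]_d.+1 :=
  row_mx p.1%:M p.2.

Lemma rV_cons0 d p : @rV_cons d p 0 ord0 = p.1.
Proof.
have -> : (ord0 : 'I_d.+1) = @lshift 1 d 0 by exact/val_inj.
by apply: (etrans (@row_mxEl _ _ 1 d p.1%:M p.2 0 0)); rewrite mxE eqxx mulr1n.
Qed.

Lemma rV_consS d p i : @rV_cons d p 0 (lift ord0 i) = p.2 0 i.
Proof.
have -> : lift ord0 i = @rshift 1 d i by exact/val_inj.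
exact: (@row_mxEr _ _ 1 d p.1%:M p.2 0 i).
Qed.

Lemma measurable_rV_cons d : measurable_fun setT (@rV_cons d).
Proof.
apply: measurable_fun_mx => i j; rewrite ord1.
case: (unliftP ord0 j) => [k ->|->].
  apply: (eq_measurable_fun ((fun v : 'rV[R]_d => v 0 k) \o snd)).
    by move=> p _; rewrite rV_consS.
  by apply: measurableT_comp => //; exact: measurable_coord.
apply: (eq_measurable_fun fst); last exact: measurable_fst.
by move=> p _; rewrite rV_cons0.
Qed.

Section step.
Local Open Scope ereal_scope.
Context {d : nat} (mu : {sigma_finite_measure set 'rV[R]_d -> \bar R}).

Definition lebesgue_cons : set 'rV[R]_d.+1 -> \bar R :=
  pushforward (@lebesgue_measure R \x mu) (@rV_cons d).

Let lebesgue_cons0 : lebesgue_cons set0 = 0.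
Proof. by rewrite /lebesgue_cons /pushforward preimage_set0 measure0. Qed.

Let lebesgue_cons_ge0 A : 0 <= lebesgue_cons A.
Proof. by rewrite /lebesgue_cons /pushforward; exact: measure_ge0. Qed.

Let lebesgue_cons_sigma_additive : semi_sigma_additive lebesgue_cons.
Proof.
have mc := @measurable_rV_cons d.
move=> F mF tF mUF; rewrite /lebesgue_cons /pushforward preimage_bigcup.
apply: measure_semi_sigma_additive.
- by move=> n; rewrite -[X in measurable X]setTI; exact: mc.
- apply/trivIsetP => /= i j _ _ ij; rewrite -preimage_setI.
  by move/trivIsetP : tF => /(_ _ _ _ _ ij) ->//; rewrite preimage_set0.
- by rewrite -preimage_bigcup -[X in measurable X]setTI; exact: mc.
Qed.

HB.instance Definition _ := isMeasure.Build _ _ _ lebesgue_cons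
  lebesgue_cons0 lebesgue_cons_ge0 lebesgue_cons_sigma_additive.

Let lebesgue_cons_sigma_finite : sigma_finite setT lebesgue_cons.
Proof.
have /sigma_finiteP[F [FT ndF Foo]] := sigma_finiteT (@lebesgue_measure R).
have /sigma_finiteP[G [GT ndG Goo]] := sigma_finiteT mu.
pose g (v : 'rV[R]_d.+1) : R * 'rV[R]_d :=
  (@lsubmx R 1 1 d v 0 0, @rsubmx R 1 1 d v)%R.
have gK : cancel (@rV_cons d) g.
  move=> [x v]; rewrite /g /rV_cons/= row_mxKl row_mxKr mxE eqxx.
  by rewrite mulr1n.
have mg : measurable_fun setT g.
  apply: measurable_fun_pair.
    apply: (eq_measurable_fun (fun v : 'rV[R]_d.+1 => v 0%R (@lshift 1 d 0%R))).
      by move=> v _; rewrite mxE.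
    exact: measurable_coord.
  apply: measurable_fun_mx => i j.
  apply: (eq_measurable_fun (fun v : 'rV[R]_d.+1 => v i (@rshift 1 d j))).
    by move=> v _; rewrite mxE.
  exact: measurable_coord.
exists (fun n => g @^-1` (F n `*` G n)).
  apply/esym/seteqP; split=> // v _.
  have : setT (g v).1 by [].
  have : setT (g v).2 by [].
  rewrite {1}GT => -[k _ Gk]; rewrite FT => -[l _ Fl].
  exists (maxn k l) => //; split.
    by move: Fl; exact/subsetPset/ndF/leq_maxr.
  by move: Gk; exact/subsetPset/ndG/leq_maxl.
move=> k; have [mFk Fkoo] := Foo k; have [mGk Gkoo] := Goo k.
have mFGk : measurable (F k `*` G k) by exact: measurableX.
split; first by rewrite -[X in measurable X]setTI; exact: mg.
rewrite /lebesgue_cons /pushforward -comp_preimage.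
rewrite (_ : g \o _ = id); last by apply/funext => p; exact: gK.
by rewrite preimage_id product_measure1E// lte_mul_pinfty// ge0_fin_numE.
Qed.

HB.instance Definition _ := Measure_isSigmaFinite.Build _ _ _ lebesgue_cons
  lebesgue_cons_sigma_finite.

End step.

Fixpoint lebesgue_rV (d : nat) : {sigma_finite_measure set 'rV[R]_d -> \bar R} :=
  if d is d'.+1 then lebesgue_cons (lebesgue_rV d')
  else @dirac _ 'rV[R]_0 0 R.

End lebesgue_rV.

Section lebesgue_rV_box.
Local Open Scope ereal_scope.
Context {R : realType}.

Lemma measurable_box d (A : 'I_d -> set R) : (forall i, measurable (A i)) ->
  measurable [set v : 'rV[R]_d | forall i, A i (v 0%R i)].
Proof.
move=> mA; rewrite (_ : [set _ | _] =
    \bigcap_(i in [set: 'I_d]) ((fun v : 'rV[R]_d => v 0%R i) @^-1` A i)).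
  apply: fin_bigcap_measurable => // i _.
  by rewrite -[X in measurable X]setTI; exact: measurable_coord.
by apply/seteqP; split=> v /= h i; [move=> _; exact: h|exact: h].
Qed.

Lemma lebesgue_rV_box d (A : 'I_d -> set R) : (forall i, measurable (A i)) ->
  lebesgue_rV d [set v | forall i, A i (v 0%R i)] =
  \prod_(i < d) lebesgue_measure (A i).
Proof.
elim: d A => [|d IHd] A mA.
  by rewrite big_ord0/= diracE mem_set// => -[].
rewrite big_ord_recl -IHd; last by move=> i; exact: mA.
have mB := measurable_box (fun i => mA (lift ord0 i)).
rewrite -(product_measure1E (@lebesgue_measure R) (lebesgue_rV d) (mA ord0) mB).
rewrite [LHS]/= /lebesgue_cons /pushforward; congr (_ _).
apply/seteqP; split=> p /=.
  by move=> h; split=> [|i]; [rewrite -rV_cons0|rewrite -rV_consS]; exact: h.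
move=> [A0 AS] i.
by case: (unliftP ord0 i) => [k ->|->]; rewrite (rV_consS, rV_cons0).
Qed.

End lebesgue_rV_box.

Section complex_integration.
Context {R : realType}.
Local Open Scope complex_scope.

Definition sqnormc (z : R[i]) : R := complex.Re z ^+ 2 + complex.Im z ^+ 2.

Definition expi (t : R) : R[i] := cos t +i* sin t.

Definition cintegral disp (T : measurableType disp)
    (mu : {measure set T -> \bar R}) (f : T -> R[i]) : R[i] :=
  (\int[mu]_x complex.Re (f x)) +i* (\int[mu]_x complex.Im (f x)).

Definition cvariance disp (T : measurableType disp) (P : probability T R)
    (X : T -> R[i]) : R :=
  \int[P]_w sqnormc (X w - cintegral P X).

End complex_integration.

Section euclidean.
Context {R : realType} {d : nat}.
Local Open Scope complex_scope.
Implicit Types (x y xi : 'rV[R]_d) (f g : 'rV[R]_d -> R[i]).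

Definition dotrV x y : R := \sum_(i < d) x 0 i * y 0 i.

(* The library norm on ['rV[R]_d] is the sup norm, so [ball] is a cube. *)
Definition eball (r : R) : set 'rV[R]_d := [set x | Num.sqrt (dotrV x x) < r].

Record test_function f : Prop := TestFunction {
  test_measurable_Re : measurable_fun setT (fun x => complex.Re (f x)) ;
  test_measurable_Im : measurable_fun setT (fun x => complex.Im (f x)) ;
  test_bounded : exists M : R, forall x, sqnormc (f x) <= M ;
  test_bounded_support : bounded_set [set x | f x != 0] }.

Definition fourier f xi : R[i] :=
  cintegral (lebesgue_rV d) (fun x => f x * expi (- (2 * pi * dotrV x xi))).

Definition convolution f g x : R[i] :=
  cintegral (lebesgue_rV d) (fun y => f y * g (x - y)).

Definition star f x : R[i] := (f (- x))^*.

Definition radon (mu : set 'rV[R]_d -> \bar R) : Prop :=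
  forall K, compact K -> (mu K < +oo)%E.

End euclidean.

(* A signed Radon measure may have infinite positive and negative total mass,
   so it is not a [charge]; it is the difference of two Radon measures, and
   only integrals of bounded, compactly supported functions make sense. *)
Record signed_radon (R : realType) (d : nat) := SignedRadon {
  sr_pos : {measure set 'rV[R]_d -> \bar R} ;
  sr_neg : {measure set 'rV[R]_d -> \bar R} ;
  sr_pos_radon : radon sr_pos ;
  sr_neg_radon : radon sr_neg }.

Definition sr_integral (R : realType) (d : nat) (eta : signed_radon R d)
    (g : 'rV[R]_d -> R[i]) : R[i] :=
  cintegral (sr_pos eta) g - cintegral (sr_neg eta) g.

(* Fourier transform of a positive-definite measure [eta] in the sense of
   Berg-Forst: the Radon measure [nu] whose integral of [|fourier f|^2] is the
   integral of [convolution f (star f)] against [eta], for every test function [f]. *)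
Definition is_fourier_transform (R : realType) (d : nat)
    (eta : signed_radon R d) (nu : {measure set 'rV[R]_d -> \bar R}) : Prop :=
  radon nu /\
  forall f, test_function f ->
    nu.-integrable setT (fun xi => (sqnormc (fourier f xi))%:E) /\
    sr_integral eta (convolution f (star f)) =
      (\int[nu]_xi sqnormc (fourier f xi))%:C%C.

(* Being Borel isomorphic to a Borel subset of the real line, which by
   Kuratowski's theorem characterizes standard Borel spaces. *)
Definition standard_borel (R : realType) disp (T : measurableType disp) : Prop :=
  exists f : T -> R, [/\ measurable_fun setT f, injective f &
    forall A, measurable A -> measurable (f @` A)].

Section point_process.
Context {R : realType} {d : nat} {disp : measure_display}.
Context {Omega : measurableType disp} (P : probability Omega R).
Implicit Types (T : 'rV[R]_d -> Omega -> Omega) (Lambda : Omega -> set 'rV[R]_d).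

Record pmp_action T : Prop := PmpAction {
  action_id : forall w, T 0 w = w ;
  action_add : forall x y w, T (x + y) w = T x (T y w) ;
  action_measurable :
    measurable_fun setT (fun p : 'rV[R]_d * Omega => T p.1 p.2) ;
  action_preserving :
    forall x A, measurable A -> P (T x @^-1` A) = P A }.

Definition locally_finite (X : set 'rV[R]_d) : Prop :=
  forall B : set 'rV[R]_d, bounded_set B -> finite_set (X `&` B).

Definition npoints Lambda (B : set 'rV[R]_d) (w : Omega) : R :=
  fine (counting (Lambda w `&` B)).

(* Measurability is with respect to the sigma-algebra on locally finite sets
   generated by the counts in bounded Borel sets. *)
Record invariant_point_process T Lambda : Prop := InvariantPointProcess {
  pp_locally_finite : forall w, locally_finite (Lambda w) ;
  pp_measurable : forall B : set 'rV[R]_d, measurable B -> bounded_set B ->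
    measurable_fun setT (npoints Lambda B) ;
  pp_equivariant : forall x w, Lambda (T x w) = [set x + y | y in Lambda w] }.

Definition locally_square_integrable Lambda : Prop :=
  forall B : set 'rV[R]_d, measurable B -> bounded_set B ->
    (\int[P]_w ((npoints Lambda B w) ^+ 2)%:E < +oo)%E.

(* For a test function [f] the sum has finitely many nonzero terms, since
   [Lambda w] is locally finite and [f] has bounded support. *)
Definition linear_statistic Lambda (f : 'rV[R]_d -> R[i]) (w : Omega) : R[i] :=
  \sum_(x \in Lambda w) f x.

Definition is_centered_autocorrelation Lambda (eta : signed_radon R d) : Prop :=
  forall f, test_function f ->
    sr_integral eta (convolution f (star f)) =
      (cvariance P (linear_statistic Lambda f))%:C%C.

Definition is_centered_diffraction Lambda
    (nu : {measure set 'rV[R]_d -> \bar R}) : Prop :=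
  exists eta : signed_radon R d,
    is_centered_autocorrelation Lambda eta /\ is_fourier_transform eta nu.

Definition geometrically_hyperuniform Lambda : Prop :=
  fine 'V_P[npoints Lambda (eball r)] / fine (lebesgue_rV d (eball r))
    @[r --> +oo] --> (0 : R).

End point_process.

Definition spectrally_hyperuniform (R : realType) (d : nat)
    (nu : {measure set 'rV[R]_d -> \bar R}) : Prop :=
  fine (nu (eball e)) / fine (lebesgue_rV d (eball e))
    @[e --> 0^'+] --> (0 : R).

(* Main.v *)
(**
Write [v r] for the variance of the number of points in the ball of radius [r] and [F r]
for the squared modulus of the Fourier transform of its indicator function, so that
[v r] is the integral of [F r] against the diffraction measure [nu]. Up to constants,
[F r xi >= r^(2 d)] when [r |xi|] is small, which gives [nu (B_(c/r)) r^(2 d) <= C v r]: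
geometric hyperuniformity implies spectral hyperuniformity. Conversely
[F r xi <= C r^(2 d) min (1, (r |xi|)^-(d+1))], and summing over the shells
[4^(k-1) <= r |xi| < 4^k] bounds [v r / r^d] by the sum of the
[4^-k nu (B_s) / s^d] with [s = 4^k / r]. This tends to [0] as soon as [nu (B_s) / s^d]
is small near [0] and bounded for large [s]. The latter follows from the first inequality
at small [r] and from [E (N_r^2) <= C r^d]: a unit cube contains about [r^-d] disjoint
translates of [B_r], and a sum of squares of counts is at most the square of their sum.

The decay of [F r] is that of the Bessel function [J_(d/2)]. Since Lebesgue measure is
invariant under reflections, the transform of the ball at [xi] only depends on [|xi|], and
slicing gives a multiple of [A t], the integral of [sqrt (1 - s^2)^(d-1) cos (t s)] over
[-1 <= s <= 1]. It satisfies [A'' + (d + 1) A' / t + A = 0], and an energy estimate for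
this equation gives [A t ^ 2 = O(t^-(d+1))].
*)
Require Import Defs.
From HB Require Import structures.
From mathcomp Require Import all_boot all_order all_algebra finmap.
From mathcomp Require Import all_classical all_reals all_analysis.
From mathcomp Require Import measurable_realfun complex ring lra.
Set Implicit Arguments.
Unset Strict Implicit.
Unset Printing Implicit Defensive.
Import Order.TTheory GRing.Theory Num.Theory.
Import numFieldNormedType.Exports.
Local Open Scope classical_set_scope.
Local Open Scope ring_scope.

(** * Lebesgue measure under translations, isometries and dilations *)

Lemma ge0_integral_measure_preserving {R : realType} disp (T : measurableType disp)
    (mu : {measure set T -> \bar R}) (phi : T -> T) (f : T -> \bar R) :
  measurable_fun setT phi ->
  (forall A, measurable A -> mu (phi @^-1` A) = mu A) ->
  measurable_fun setT f -> (forall x, 0 <= f x)%E ->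
  (\int[mu]_x f (phi x) = \int[mu]_x f x)%E.
Proof.
move=> mphi pphi mf f0.
rewrite -[LHS](@ge0_integral_pushforward _ _ _ _ R phi mphi mu setT f)//.
by apply: eq_measure_integral => A mA _; exact: pphi.
Qed.

Section translation.
Context {R : realType}.

(** The shifted measure gives each half-open interval its length, and this characterizes Lebesgue
    measure on the line. *)
Lemma lebesgue_measure_translate (a : R) (A : set R) : measurable A ->
  lebesgue_measure ((fun x => x + a) @^-1` A) = lebesgue_measure A.
Proof.
have ma : measurable_fun setT ((fun x => x + a) : R -> measurableTypeR R).
  exact: measurable_funD.
move=> mA; apply/esym.
rewrite -/(pushforward (@lebesgue_measure R) ((fun x => x + a) : R -> measurableTypeR R) A).
apply: lebesgue_measure_unique => //= _ [[b c]] _ <-.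
rewrite /pushforward (_ : _ @^-1` _ = `]b - a, c - a]%classic); last first.
  by apply/seteqP; split => x /=; rewrite !in_itv/= ltrBlDr lerBrDr.
by rewrite !lebesgue_measure_itv/= !lte_fin ltrD2r -!EFinB opprB addrA subrK.
Qed.

Lemma measurable_mxD m n disp (T : measurableType disp)
    (f g : T -> 'M[R]_(m, n)) :
  measurable_fun setT f -> measurable_fun setT g ->
  measurable_fun setT (fun x => f x + g x).
Proof.
move=> mf mg; apply: measurable_fun_mx => i j.
under eq_fun do rewrite mxE.
by apply: measurable_funD; exact: (measurableT_comp (measurable_coord i j)).
Qed.

Lemma measurable_mxZ m n disp (T : measurableType disp) (k : T -> R)
    (f : T -> 'M[R]_(m, n)) :
  measurable_fun setT k -> measurable_fun setT f ->
  measurable_fun setT (fun x => k x *: f x).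
Proof.
move=> mk mf; apply: measurable_fun_mx => i j.
under eq_fun do rewrite mxE.
by apply: measurable_funM => //; exact: (measurableT_comp (measurable_coord i j)).
Qed.

Lemma measurable_mxN m n disp (T : measurableType disp) (f : T -> 'M[R]_(m, n)) :
  measurable_fun setT f -> measurable_fun setT (fun x => - f x).
Proof.
move=> mf; apply: (eq_measurable_fun (fun x => -1 *: f x)).
  by move=> x _; rewrite scaleN1r.
exact: measurable_mxZ.
Qed.

Lemma rV_consD d (p q : R * 'rV[R]_d) :
  rV_cons p + rV_cons q = rV_cons (p.1 + q.1, p.2 + q.2).
Proof.
apply/rowP => j; rewrite [LHS]mxE.
by case: (unliftP ord0 j) => [k ->|->]; rewrite ?(rV_consS, rV_cons0)//= mxE.
Qed.

Lemma rV_cons_surj d (v : 'rV[R]_d.+1) : exists p, v = rV_cons p.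
Proof.
exists (v 0 ord0, \row_i v 0 (lift ord0 i)); apply/rowP => j.
by case: (unliftP ord0 j) => [k ->|->]; rewrite (rV_consS, rV_cons0) ?mxE.
Qed.

Lemma lebesgue_rVS d (A : set 'rV[R]_d.+1) :
  lebesgue_rV d.+1 A =
  (\int[lebesgue_measure]_x lebesgue_rV d (xsection (@rV_cons R d @^-1` A) x))%E.
Proof. by []. Qed.

Lemma measurable_preimage_setT disp disp' (T : measurableType disp)
    (U : measurableType disp') (f : T -> U) (A : set U) :
  measurable_fun setT f -> measurable A -> measurable (f @^-1` A).
Proof. by move=> mf mA; rewrite -[X in measurable X]setTI; exact: mf. Qed.

Lemma measurable_indic_comp disp disp' (T : measurableType disp)
    (U : measurableType disp') (f : T -> U) (A : set U) :
  measurable_fun setT f -> measurable A ->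
  measurable_fun setT (fun x => \1_A (f x) : R).
Proof.
move=> mf mA; apply: (eq_measurable_fun (\1_(f @^-1` A) : T -> R)) => [x _|]; first by [].
 apply: measurable_indic.
exact: measurable_preimage_setT.
Qed.

(** Induction on the dimension: the shift by [a'] acts inside the slices, where the induction
    hypothesis applies, and the shift by [a0] permutes the slices, which one-dimensional invariance
    handles. *)
Lemma lebesgue_rV_translate d (a : 'rV[R]_d) (A : set 'rV[R]_d) : measurable A ->
  lebesgue_rV d ((fun v => v + a) @^-1` A) = lebesgue_rV d A.
Proof.
elim: d a A => [|d IH] a A mA.
  by congr (lebesgue_rV 0 _); apply/seteqP; split => v /=; rewrite [v + a]thinmx0 [v]thinmx0.
have [[a0 a'] ->] := rV_cons_surj a.
have mcA : measurable (@rV_cons R d @^-1` A).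
  by apply: measurable_preimage_setT => //; exact: measurable_rV_cons.
rewrite !lebesgue_rVS.
have ma : measurable_fun setT ((fun x => x + a0) : R -> measurableTypeR R).
  exact: measurable_funD.
apply/esym/(etrans (esym (@ge0_integral_measure_preserving R _ (measurableTypeR R)
  lebesgue_measure _ (fun x => lebesgue_rV d (xsection (@rV_cons R d @^-1` A) x))
  ma _ _ _))) => //.
- by move=> B mB; exact: lebesgue_measure_translate.
- exact: measurable_fun_xsection.
apply/esym.
apply: eq_integral => x _. rewrite -[RHS](IH a'); last exact: measurable_xsection.
congr (lebesgue_rV d _); apply/seteqP; split => v /=; rewrite !xsectionE/=;
  by rewrite rV_consD.
Qed.


Local Notation lam d := (lebesgue_rV d : {measure set 'rV[R]_d -> \bar R}).

(* Both sides equal the integral of [1_A (L x) 1_B (L x + y)] over [(x, y)]: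
   integrate in [y] first, or substitute [x - M y] for [x] and use Tonelli. *)
Lemma lebesgue_rV_preimage_mul d (L M : 'rV[R]_d -> 'rV[R]_d) (A B : set 'rV[R]_d) :
  measurable_fun setT L -> (forall x y, L (x - M y) = L x - y) ->
  measurable A -> measurable B ->
  (lebesgue_rV d (L @^-1` A) * lebesgue_rV d B =
   lebesgue_rV d (L @^-1` B) * lebesgue_rV d (-%R @^-1` A))%E.
Proof.
move=> mL LM mA mB.
pose m := lam d.
have mLA := measurable_preimage_setT mL mA.
have mLB := measurable_preimage_setT mL mB.
have mN : measurable_fun setT (-%R : 'rV[R]_d -> 'rV[R]_d) by exact: measurable_mxN.
have mNA := measurable_preimage_setT mN mA.
have mshift (x : 'rV[R]_d) : measurable_fun setT (fun y : 'rV[R]_d => y + x).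
  exact: measurable_mxD.
have mL1 : measurable_fun setT (fun p : 'rV[R]_d * 'rV[R]_d => L p.1).
  exact: measurableT_comp.
pose f (p : 'rV[R]_d * 'rV[R]_d) : \bar R := (\1_A (L p.1) * \1_B (L p.1 + p.2))%:E.
pose g (p : 'rV[R]_d * 'rV[R]_d) : \bar R := (\1_A (L p.1 - p.2) * \1_B (L p.1))%:E.
have mf : measurable_fun setT f.
  apply/measurable_EFinP; apply: measurable_funM.
    exact: measurable_indic_comp.
  by apply: measurable_indic_comp => //; exact: measurable_mxD.
have mg : measurable_fun setT g.
  apply/measurable_EFinP; apply: measurable_funM.
    by apply: measurable_indic_comp => //; apply: measurable_mxD => //; exact: measurable_mxN.
  exact: measurable_indic_comp.
have f0 p : (0 <= f p)%E by rewrite lee_fin mulr_ge0.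
have g0 p : (0 <= g p)%E by rewrite lee_fin mulr_ge0.
have mfy y : measurable_fun setT (fun x => f (x, y)) by exact: measurableT_comp.
have mt (z : 'rV[R]_d) C : measurable C -> m ((fun y => y + z) @^-1` C) = m C.
  exact: lebesgue_rV_translate.
have intf x : (\int[m]_y f (x, y) = (\1_A (L x))%:E * m B)%E.
  transitivity (\int[m]_y ((\1_A (L x))%:E * (\1_B (L x + y))%:E))%E; first by [].
  rewrite ge0_integralZl//; last first.
  - by apply/measurable_EFinP; apply: measurable_indic_comp => //; exact: measurable_mxD.
  congr (_ * _)%E.
  have := @integral_indic _ _ _ m _ measurableT _
    (measurable_preimage_setT (mshift (L x)) mB).
  rewrite setIT mt// => <-.
  by apply: eq_integral => y _; rewrite addrC.
have intg x : (\int[m]_y g (x, y) = (\1_B (L x))%:E * m (-%R @^-1` A))%E.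
  transitivity (\int[m]_y ((\1_B (L x))%:E * (\1_A (L x - y))%:E))%E.
    by apply: eq_integral => y _; rewrite /g/= mulrC EFinM.
  rewrite ge0_integralZl//; last first.
  - apply/measurable_EFinP; apply: measurable_indic_comp => //.
    by apply: measurable_mxD => //; exact: measurable_mxN.
  congr (_ * _)%E.
  have := @integral_indic _ _ _ m _ measurableT _
    (measurable_preimage_setT (mshift (- L x)) mNA).
  rewrite setIT mt// => <-.
  by apply: eq_integral => y _; rewrite -(opprB y).
transitivity (\int[m]_x \int[m]_y f (x, y))%E.
  under eq_integral do rewrite intf.
  rewrite ge0_integralZr//; last first.
    by apply/measurable_EFinP; exact: measurable_indic_comp.
  by have := @integral_indic _ _ _ m _ measurableT _ mLA; rewrite setIT => <-.
rewrite fubini_tonelli//.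
transitivity (\int[m]_y \int[m]_x g (x, y))%E.
  apply: eq_integral => y _.
  rewrite -(ge0_integral_measure_preserving (mshift (- M y)))//.
    by apply: eq_integral => x _; rewrite /f /g/= LM subrK.
  by move=> C mC; exact: lebesgue_rV_translate.
rewrite -fubini_tonelli//.
under eq_integral do rewrite intg.
rewrite ge0_integralZr//; last first.
  by apply/measurable_EFinP; exact: measurable_indic_comp.
by have := @integral_indic _ _ _ m _ measurableT _ mLB; rewrite setIT => <-.
Qed.

End translation.

(** * Euclidean norm and balls; effect of isometries and dilations on Lebesgue measure *)

Section euclidean_geometry.
Context {R : realType}.
Implicit Types d : nat.

Lemma dotrVC d (x y : 'rV[R]_d) : dotrV x y = dotrV y x.
Proof. by apply: eq_bigr => i _; rewrite mulrC. Qed.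

Lemma dotrVDl d (x y z : 'rV[R]_d) : dotrV (x + y) z = dotrV x z + dotrV y z.
Proof. by rewrite -big_split/=; apply: eq_bigr => i _; rewrite mxE mulrDl. Qed.

Lemma dotrVZl d k (x z : 'rV[R]_d) : dotrV (k *: x) z = k * dotrV x z.
Proof. by rewrite /dotrV mulr_sumr; apply: eq_bigr => i _; rewrite mxE mulrA. Qed.

Lemma dotrVNl d (x z : 'rV[R]_d) : dotrV (- x) z = - dotrV x z.
Proof. by rewrite -scaleN1r dotrVZl mulN1r. Qed.

Lemma dotrVBl d (x y z : 'rV[R]_d) : dotrV (x - y) z = dotrV x z - dotrV y z.
Proof. by rewrite dotrVDl dotrVNl. Qed.

Lemma dotrVBr d (x y z : 'rV[R]_d) : dotrV z (x - y) = dotrV z x - dotrV z y.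
Proof. by rewrite !(dotrVC z) dotrVBl. Qed.

Lemma dotrVZr d k (x z : 'rV[R]_d) : dotrV z (k *: x) = k * dotrV z x.
Proof. by rewrite !(dotrVC z) dotrVZl. Qed.

Lemma dotrV_ge0 d (x : 'rV[R]_d) : 0 <= dotrV x x.
Proof. by apply: sumr_ge0 => i _; rewrite -expr2 sqr_ge0. Qed.

Lemma dotrV_eq0 d (x : 'rV[R]_d) : dotrV x x = 0 -> x = 0.
Proof.
move=> x0; apply/rowP => i; rewrite mxE; apply/eqP; rewrite -sqrf_eq0 expr2; apply/eqP.
apply: (psumr_eq0P (P := xpredT) (F := fun i => x 0 i * x 0 i)) => // j _.
by rewrite -expr2 sqr_ge0.
Qed.

Lemma measurable_dotrV d disp (T : measurableType disp) (f g : T -> 'rV[R]_d) :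
  measurable_fun setT f -> measurable_fun setT g ->
  measurable_fun setT (fun t => dotrV (f t) (g t)).
Proof.
move=> mf mg; apply: measurable_sum => i.
by apply: measurable_funM; exact: (measurableT_comp (measurable_coord 0 i)).
Qed.

Definition enorm d (x : 'rV[R]_d) : R := Num.sqrt (dotrV x x).

Lemma enorm_ge0 d (x : 'rV[R]_d) : 0 <= enorm x. Proof. exact: sqrtr_ge0. Qed.

Lemma sqr_enorm d (x : 'rV[R]_d) : enorm x ^+ 2 = dotrV x x.
Proof. by rewrite sqr_sqrtr// dotrV_ge0. Qed.

Lemma enormZ d k (x : 'rV[R]_d) : enorm (k *: x) = `|k| * enorm x.
Proof. by rewrite /enorm dotrVZl dotrVZr mulrA -expr2 sqrtrM ?sqr_ge0// sqrtr_sqr. Qed.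

Lemma enormN d (x : 'rV[R]_d) : enorm (- x) = enorm x.
Proof. by rewrite -scaleN1r enormZ normrN1 mul1r. Qed.

Lemma le_coord_enorm d (x : 'rV[R]_d) i : `|x 0 i| <= enorm x.
Proof.
rewrite -sqrtr_sqr ler_wsqrtr// /dotrV (bigD1 i)//= -expr2 lerDl.
by apply: sumr_ge0 => j _; rewrite -expr2 sqr_ge0.
Qed.

Lemma measurable_enorm d : measurable_fun setT (@enorm d).
Proof.
apply: (measurableT_comp (f := @Num.sqrt R)).
  by apply: continuous_measurable_fun; exact: sqrt_continuous.
exact: measurable_dotrV.
Qed.

Lemma eballE d (r : R) : eball r = [set x : 'rV[R]_d | enorm x < r].
Proof. by []. Qed.

Lemma measurable_eball d (r : R) : measurable (@eball R d r).
Proof.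
rewrite eballE (_ : [set _ | _] = @enorm d @^-1` `]-oo, r[%classic); last first.
  by apply/seteqP; split => x /=; rewrite in_itv.
by apply: measurable_preimage_setT => //; exact: measurable_enorm.
Qed.

Lemma bounded_coord d (A : set 'rV[R]_d) (M : R) :
  (forall x, A x -> forall i, `|x 0 i| <= M) -> bounded_set A.
Proof.
move=> AM; exists `|M|; split; first exact: num_real.
move=> s Ms x Ax; change (mx_norm x <= s); rewrite mx_normrE; apply/bigmax_leP; split.
  by rewrite (le_trans _ (ltW Ms)).
move=> [i j] _ /=; rewrite ord1 (le_trans (AM x Ax j))//.
by rewrite (le_trans (ler_norm _))// ltW.
Qed.

Lemma bounded_eball d (r : R) : bounded_set (@eball R d r).
Proof.
apply: (bounded_coord (M := r)) => x; rewrite eballE /= => xr i.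
by rewrite (le_trans (le_coord_enorm _ _))// ltW.
Qed.

Lemma measurable_cube d (a b : R) :
  measurable [set v : 'rV[R]_d | forall i, `[a, b]%classic (v 0 i)].
Proof. exact: (measurable_box (fun=> measurable_itv _)). Qed.

(** [radon] only speaks of compact sets; a bounded set lies in a closed cube, which is compact. *)
Lemma radon_bounded_lty d (nu : {measure set 'rV[R]_d -> \bar R}) (A : set 'rV[R]_d) :
  radon nu -> measurable A -> bounded_set A -> (nu A < +oo)%E.
Proof.
move=> rnu mA [M [_ AM]].
pose K := [set x : 'rV[R]_d | forall i, `[- (M + 1), M + 1]%classic (x 0 i)].
have cK : compact K.
  apply: (@rV_compact _ _ (fun=> `[- (M + 1), M + 1]%classic)) => i.
  exact: segment_compact.
apply: le_lt_trans (rnu K cK); apply: le_measure; rewrite ?inE//.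
  exact: measurable_cube.
move=> x Ax i; rewrite /= in_itv/= -ler_norml.
have /AM /(_ x Ax) : M < M + 1 by rewrite ltrDl.
change (mx_norm x <= M + 1 -> `|x 0 i| <= M + 1).
by rewrite mx_normrE => /bigmax_leP[_ /(_ (0, i))]; exact.
Qed.

Lemma lebesgue_rV_cube d (a b : R) : a <= b ->
  lebesgue_rV d [set v : 'rV[R]_d | forall i, `[a, b]%classic (v 0 i)] = ((b - a) ^+ d)%:E.
Proof.
move=> ab; rewrite (lebesgue_rV_box (fun=> measurable_itv _)).
rewrite (eq_bigr (fun=> (b - a)%:E)); last first.
  move=> i _; rewrite lebesgue_measure_itv/= lte_fin.
  by case: ltgtP ab => // -> _; rewrite subrr.
by rewrite prodEFin prodr_const card_ord.
Qed.

Lemma lebesgue_rV_eball_lty d (r : R) : (lebesgue_rV d (@eball R d r) < +oo)%E.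
Proof.
apply: (@le_lt_trans _ _ (lebesgue_rV d
  [set v : 'rV[R]_d | forall i, `[- `|r|, `|r|]%classic (v 0 i)])); last first.
  by rewrite lebesgue_rV_cube ?ltry// lerNl (le_trans _ (normr_ge0 _))// oppr_le0.
apply: le_measure; rewrite ?inE//; first exact: measurable_eball.
  exact: measurable_cube.
move=> x; rewrite eballE /= => xr i; rewrite in_itv/= -ler_norml.
by rewrite (le_trans (le_coord_enorm _ _))// (le_trans (ltW xr))// ler_norm.
Qed.

Lemma lebesgue_rV_eball_gt0 d (r : R) : 0 < r -> (0 < lebesgue_rV d (@eball R d r))%E.
Proof.
move=> r0; pose s := r / d.+1%:R.
have s0 : 0 < s by rewrite divr_gt0.
apply: (@lt_le_trans _ _ (lebesgue_rV d
  [set v : 'rV[R]_d | forall i, `[0, s]%classic (v 0 i)])).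
  by rewrite lebesgue_rV_cube ?ltW// subr0 lte_fin exprn_gt0.
apply: le_measure; rewrite ?inE//.
- exact: measurable_cube.
- exact: measurable_eball.
move=> x xs; rewrite eballE /= -(ltr_pXn2r (n := 2))// ?nnegrE ?enorm_ge0 ?ltW//.
rewrite sqr_enorm; apply: (@le_lt_trans _ _ (\sum_(i < d) s ^+ 2)).
  apply: ler_sum => i _; have := xs i; rewrite /= in_itv/= => /andP[x0 xis].
  by rewrite expr2 ler_pM.
rewrite sumr_const card_ord -mulr_natr expr_div_n mulrAC ltr_pdivrMr ?exprn_gt0//.
rewrite ltr_pM2l ?exprn_gt0// -natrX ltr_nat.
by rewrite expnS expn1 leq_pmulr.
Qed.

(** Take the unit ball for [B] in [lebesgue_rV_preimage_mul]. It equals its preimage under [L] and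
    has positive finite volume, so it cancels, and the preimage of [A] has the measure of [-A]. The
    same argument for the identity map shows that [-A] has the measure of [A]. *)
Lemma lebesgue_rV_preserving d (L M : 'rV[R]_d -> 'rV[R]_d) (A : set 'rV[R]_d) :
  measurable_fun setT L -> (forall x y, L (x - M y) = L x - y) ->
  (forall x, enorm (L x) = enorm x) ->
  measurable A -> lebesgue_rV d (L @^-1` A) = lebesgue_rV d A.
Proof.
have cancel_eball (x y : \bar R) :
    (x * lebesgue_rV d (@eball R d 1) = lebesgue_rV d (@eball R d 1) * y)%E -> x = y.
  have b1 := lebesgue_rV_eball_gt0 d (@ltr01 R).
  have b1oo := lebesgue_rV_eball_lty d 1.
  have bfin : lebesgue_rV d (@eball R d 1) \is a fin_num by rewrite ge0_fin_numE.
  rewrite muleC => xy; apply/le_anti.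
  by apply/andP; split; rewrite -(lee_pmul2l bfin b1) xy lexx.
move=> mL LM Le mA; have mB := @measurable_eball d 1.
have LB : L @^-1` eball 1 = eball 1 by apply/seteqP; split => x; rewrite !eballE /= Le.
have := lebesgue_rV_preimage_mul mL LM mA mB; rewrite LB => /cancel_eball ->.
have := @lebesgue_rV_preimage_mul R d id id _ _ (@measurable_id _ _ setT)
  (fun x y => erefl) mA mB.
by rewrite !preimage_id => /cancel_eball.
Qed.

Lemma lebesgue_rV_opp d (A : set 'rV[R]_d) : measurable A ->
  lebesgue_rV d (-%R @^-1` A) = lebesgue_rV d A.
Proof.
apply: (lebesgue_rV_preserving (M := -%R)).
- exact: measurable_mxN.
- by move=> x y; rewrite opprB addrC.
- exact: enormN.
Qed.

(** In [lebesgue_rV_preimage_mul], [B] is now the unit cube; its preimage is the cube of side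
    [r^-1], whose volume yields the factor. *)
Lemma lebesgue_rV_scale d (r : R) (A : set 'rV[R]_d) : 0 < r -> measurable A ->
  (lebesgue_rV d A = (r ^+ d)%:E * lebesgue_rV d ( *:%R r @^-1` A))%E.
Proof.
move=> r0 mA.
have mr : measurable_fun setT ( *:%R r : 'rV[R]_d -> 'rV[R]_d).
  exact: measurable_mxZ.
have LM (x y : 'rV[R]_d) : r *: (x - r^-1 *: y) = r *: x - y.
  by rewrite scalerBr scalerA divff ?scale1r// gt_eqF.
pose B := [set v : 'rV[R]_d | forall i, `[0, 1]%classic (v 0 i)].
have mB : measurable B by exact: measurable_cube.
have := lebesgue_rV_preimage_mul mr LM mA mB.
rewrite lebesgue_rV_cube// subr0 expr1n mule1 lebesgue_rV_opp// => ->.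
rewrite (_ : _ @^-1` B = [set v : 'rV[R]_d | forall i, `[0, r^-1]%classic (v 0 i)]).
  rewrite lebesgue_rV_cube ?invr_ge0 ?ltW// subr0 muleA -EFinM -exprMn divff ?gt_eqF//.
  by rewrite expr1n mul1e.
have scale_itv i (v : 'rV[R]_d) :
    (`[0, 1]%classic ((r *: v) 0 i)) <-> (`[0, r^-1]%classic (v 0 i)).
  by rewrite /= !in_itv/= mxE pmulr_rge0// -ler_pdivlMl// mulr1.
by apply/seteqP; split => v vi i; apply/scale_itv; exact: vi.
Qed.

Lemma lebesgue_rV_eball d (r : R) : 0 < r ->
  (lebesgue_rV d (@eball R d r) = (r ^+ d)%:E * lebesgue_rV d (@eball R d 1))%E.
Proof.
move=> r0; rewrite (lebesgue_rV_scale r0); last exact: measurable_eball.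
congr (_ * lebesgue_rV d _)%E; apply/seteqP; split => x;
  by rewrite !eballE /= enormZ gtr0_norm// -ltr_pdivlMl// mulVf ?gt_eqF.
Qed.

(** [H] is the Householder reflection along [u = xi - enorm xi *: e], which exchanges [xi] and
    [enorm xi *: e]. It is a self-adjoint involution, hence preserves the norm. If [u = 0], then [H]
    is the identity and [xi] already is [enorm xi *: e]. *)
Lemma exists_isometry d (xi : 'rV[R]_d.+1) : exists H : 'rV[R]_d.+1 -> 'rV[R]_d.+1,
  [/\ measurable_fun setT H,
      forall A, measurable A -> lebesgue_rV d.+1 (H @^-1` A) = lebesgue_rV d.+1 A,
      forall x, enorm (H x) = enorm x &
      forall x, dotrV (H x) xi = enorm xi * x 0 ord0].
Proof.
pose e : 'rV[R]_d.+1 := delta_mx 0 ord0.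
have dote x : dotrV x e = x 0 ord0.
  rewrite /dotrV (bigD1 ord0)//= mxE !eqxx mulr1 big1 ?addr0// => i i0.
  by rewrite mxE (negbTE i0) andbF mulr0.
have [u uE] : exists u, u = xi - enorm xi *: e by eexists.
pose H x := x - (2 * dotrV x u / dotrV u u) *: u.
have HE x y : dotrV (H x) y = dotrV x y - 2 * dotrV x u / dotrV u u * dotrV u y.
  by rewrite dotrVBl dotrVZl.
have HC x y : dotrV (H x) y = dotrV x (H y).
  by rewrite HE dotrVBr dotrVZr (dotrVC y u); ring.
have ee : e 0 ord0 = 1 by rewrite mxE !eqxx.
(* The vectors [xi] and [enorm xi *: e] have the same norm. When [u] is nonzero, this makes the
   coefficient of [u] in [H xi] equal to 1. *)
have uu : dotrV u u = 2 * dotrV xi u.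
  rewrite uE !dotrVBl !dotrVBr !dotrVZl !dotrVZr (dotrVC e xi) !dote ee -sqr_enorm; ring.
have HH x : H (H x) = x.
  rewrite {1}/H HE; have [u0|u0] := eqVneq (dotrV u u) 0.
    by rewrite (dotrV_eq0 u0) !scaler0 /H (dotrV_eq0 u0) !scaler0 !subr0.
  rewrite /H -addrA -opprD -scalerDl [X in X *: _](_ : _ = 0) ?scale0r ?subr0//.
  by field.
have Hxi : H xi = enorm xi *: e.
  rewrite /H -uu; have [u0|u0] := eqVneq (dotrV u u) 0.
    rewrite (dotrV_eq0 u0) scaler0 subr0.
    by move/dotrV_eq0/eqP : u0; rewrite uE subr_eq0 => /eqP.
  by rewrite divff// scale1r uE opprB addrC subrK.
have HB x y : H (x - y) = H x - H y.
  by rewrite /H dotrVBl; apply/rowP => i; rewrite !mxE; ring.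
have mH : measurable_fun setT H.
  apply: measurable_mxD => //; apply: measurable_mxN; apply: measurable_mxZ => //.
  by apply: measurable_funM => //; apply: measurable_funM => //; exact: measurable_dotrV.
have He x : enorm (H x) = enorm x by rewrite /enorm HC HH.
exists H; split => //.
- by move=> A; apply: (lebesgue_rV_preserving (M := H)) => // x y; rewrite HB HH.
- by move=> x; rewrite HC Hxi dotrVZr dote.
Qed.

End euclidean_geometry.

(** * A Bessel-type decay estimate *)

Section trigonometric_integral.
Context {R : realType}.
Local Notation mu := (@lebesgue_measure R).
Local Notation I := (`[(-1 : R), 1]%classic).

Lemma continuous_integrable_itv (g : R -> R) : continuous g ->
  mu.-integrable I (EFin \o g).
Proof.
move=> cg; apply: continuous_compact_integrable; first exact: segment_compact.
exact: continuous_subspaceT.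
Qed.

Let scaleE (x y : R) : x *: (y : R^o) = x * y. Proof. by []. Qed.

Definition cosint (w : R -> R) (t : R) : R := \int[mu]_(s in I) (w s * cos (t * s)).
Definition sinint (w : R -> R) (t : R) : R := \int[mu]_(s in I) (w s * sin (t * s)).

Lemma continuous_cosM (t : R) : continuous (fun s : R => cos (t * s)).
Proof.
by move=> s; apply: continuous_comp; [exact: mulrl_continuous|exact: continuous_cos].
Qed.

Lemma continuous_sinM (t : R) : continuous (fun s : R => sin (t * s)).
Proof.
by move=> s; apply: continuous_comp; [exact: mulrl_continuous|exact: continuous_sin].
Qed.

Lemma continuousMfun (f g : R -> R) : continuous f -> continuous g ->
  continuous (fun s : R => f s * g s).
Proof. by move=> cf cg s; apply: continuousM; [exact: cf|exact: cg]. Qed.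

(** Differentiation under the integral sign: since [|h'| <= 1], the derivative of the integrand is
    dominated by [|s * w s|] uniformly in [t], so any neighbourhood of [t] will do. *)
Let is_derive_under (w : R -> R) (h h' : R -> R) (t : R) :
  continuous w -> continuous h -> (forall x : R, is_derive x (1 : R) h (h' x)) ->
  (forall x, `|h' x| <= 1) ->
  is_derive t (1 : R) (fun t => \int[mu]_(s in I) (w s * h (t * s)))
    (\int[mu]_(s in I) (s * w s * h' (t * s))).
Proof.
move=> cw ch dh h1.
pose f (x s : R) := w s * h (x * s).
have df (x s : R) : is_derive x 1 (f ^~ s) (s * w s * h' (x * s)).
  have dhs : is_derive x 1 (h \o (fun x => x * s)) (h' (x * s) * s).
    apply: is_derive1_comp; apply: is_derive_eq. by rewrite scaler0 add0r [LHS]mulr1.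
  have -> : s * w s * h' (x * s) = w s * (h' (x * s) * s) by ring.
  exact: (@is_deriveZ _ _ _ _ (w s) x 1 _ dhs).
have Pf x s : partial1of2 f x s = s * w s * h' (x * s).
  by rewrite partial1of2E; apply: derive_val.
have intf x : mu.-integrable I (EFin \o f x).
  apply: continuous_integrable_itv; apply: continuousMfun => // s.
  by apply: continuous_comp; [exact: mulrl_continuous|exact: ch].
have intG : mu.-integrable I (EFin \o (fun s => `|s * w s|)).
  apply: continuous_integrable_itv => s.
  apply: (@continuous_comp _ _ _ (fun s : R => s * w s) (fun x : R => `|x|)).
    by apply: continuousM; [exact: cvg_id|exact: cw].
  exact: norm_continuous.
have tI : `]t - 1, t + 1[%classic t.
  by rewrite /= in_itv/= ltrBlDr !ltrDl ltr01.
have mI : measurable I by [].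
have ub x s : `]t - 1, t + 1[%classic x -> I s -> `|partial1of2 f x s| <= `|s * w s|.
  by move=> _ _; rewrite Pf normrM ler_piMr.
have dd x s : `]t - 1, t + 1[%classic x -> I s -> derivable (f ^~ s) x 1.
  by move=> _ _; have [] := df x s.
have := @derivable_under_integral R _ _ mu f I mI t (t - 1) (t + 1) tI
  (fun x _ => intf x) dd (fun s => `|s * w s|) (fun=> normr_ge0 _) intG ub.
have := @differentiation_under_integral R _ _ mu f I mI t (t - 1) (t + 1) tI
  (fun x _ => intf x) dd (fun s => `|s * w s|) (fun=> normr_ge0 _) intG ub.
move=> dF eF; apply: DeriveDef => //; rewrite -derive1E dF.
by apply: eq_Rintegral => s _; rewrite -Pf.
Qed.

Lemma is_derive_cosint (w : R -> R) (t : R) : continuous w ->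
  is_derive t (1 : R) (cosint w) (- sinint (fun s => s * w s) t).
Proof.
move=> cw; refine (is_derive_eq (@is_derive_under w cos (fun x => - sin x) t cw _ _ _) _).
- exact: continuous_cos.
- by move=> x; rewrite normrN ler_norml sin_geN1 sin_le1.
rewrite /sinint -[RHS]mulN1r -[RHS]RintegralZl//.
  by apply: eq_Rintegral => s _; rewrite mulrN mulN1r.
apply: continuous_integrable_itv; apply: continuousMfun; last exact: continuous_sinM.
by apply: continuousMfun => //; move=> ?; exact: cvg_id.
Qed.

Lemma is_derive_sinint (w : R -> R) (t : R) : continuous w ->
  is_derive t (1 : R) (sinint w) (cosint (fun s => s * w s) t).
Proof.
move=> cw; apply: (@is_derive_under w sin cos) => //.
- exact: continuous_sin.
- by move=> x; rewrite ler_norml cos_geN1 cos_le1.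
Qed.

Lemma continuous_half_disk p : continuous (fun s : R => Num.sqrt (1 - s ^+ 2) ^+ p).
Proof.
move=> s; apply: (@continuous_comp _ _ _ (fun s : R => Num.sqrt (1 - s ^+ 2)) (fun x => x ^+ p)).
  apply: (@continuous_comp _ _ _ (fun s : R => 1 - s ^+ 2)); last exact: sqrt_continuous.
  by apply: continuousB; [exact: cst_continuous|exact: exprn_continuous].
exact: exprn_continuous.
Qed.

Context (p : nat).
Local Notation n := p.+2.
Let w (s : R) : R := Num.sqrt (1 - s ^+ 2) ^+ p.
Let A := cosint w.
Let B := sinint (fun s => s * w s).

Let cw : continuous w. Proof. exact: continuous_half_disk. Qed.
Let csw : continuous (fun s : R => s * w s).
Proof. by apply: continuousMfun => //; move=> ?; exact: cvg_id. Qed.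
Let cssw : continuous (fun s : R => s * (s * w s)).
Proof. by apply: continuousMfun => //; move=> ?; exact: cvg_id. Qed.

(* Integrate the derivative of [sqrt (1 - s^2) ^ (p+2) * sin (t s)] over [-1, 1]. *)
Lemma cosint_by_parts t :
  t * (A t - cosint (fun s => s * (s * w s)) t) = n%:R * B t.
Proof.
pose v (s : R) : R := Num.sqrt (1 - s ^+ 2) ^+ n.
pose F s := v s * sin (t * s).
pose f s := t * (v s * cos (t * s)) - n%:R * (s * w s * sin (t * s)).
have cv : continuous v by exact: continuous_half_disk.
have cF : continuous F by apply: continuousMfun => //; exact: continuous_sinM.
have c1 : continuous (fun s : R => v s * cos (t * s)).
  by apply: continuousMfun => //; exact: continuous_cosM.
have c2 : continuous (fun s : R => s * w s * sin (t * s)).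
  by apply: continuousMfun => //; exact: continuous_sinM.
have cf : continuous f.
  move=> s; apply: (@continuousB _ _ _ (fun s => t * (v s * cos (t * s)))
    (fun s => n%:R * (s * w s * sin (t * s)))).
  - by apply: continuousM; [exact: cst_continuous|exact: c1].
  - by apply: continuousM; [exact: cst_continuous|exact: c2].
(* The square root is not differentiable at 0, so the derivative is computed in the open interval
   only; continuity at the endpoints is enough for the fundamental theorem of calculus. *)
have dF (s : R) : s \in `]-1, 1[ -> is_derive s 1 F (f s).
  rewrite in_itv/= => /andP[s1 s2].
  have q0 : 0 < 1 - s ^+ 2.
    rewrite subr_gt0 -[X in _ < X](expr1n _ 2) -[s ^+ 2]real_normK ?num_real//.
    by rewrite ltr_pXn2r ?nnegrE// ltr_norml s1.
  have d1 : is_derive s 1 (fun s : R => 1 - s ^+ 2) (- (2 * s)).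
    by apply: is_derive_eq; rewrite !scaleE; ring.
  have d2 : is_derive s 1 (Num.sqrt \o (fun s : R => 1 - s ^+ 2))
      ((2 * Num.sqrt (1 - s ^+ 2))^-1 * - (2 * s)).
    by apply: is_derive1_comp; exact: is_derive1_sqrt.
  have d3 : is_derive s 1 v (- (n%:R * (s * w s))).
    have := @is_deriveX _ _ _ n _ _ _ d2; rewrite exprfctE => d2n.
    refine (is_derive_eq d2n _).
    rewrite scaleE /w /= exprS.
    have : Num.sqrt (1 - s ^+ 2) != 0 by rewrite gt_eqF// sqrtr_gt0.
    by move=> ?; field.
  have d4 : is_derive s 1 (sin \o (fun s => t * s)) (cos (t * s) * t).
    by apply: is_derive1_comp; apply: is_derive_eq; rewrite !scaleE; ring.
  refine (is_derive_eq (is_deriveM d3 d4) _).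
  by rewrite /f !scaleE /=; ring.
have dFLR : derivable_oo_LRcontinuous F (-1) 1.
  split; first by move=> s /dF[].
    by apply: cvg_at_right_filter; exact: cF.
  by apply: cvg_at_left_filter; exact: cF.
have dFf : {in `]-1, 1[, derive1 F =1 f}.
  by move=> s /dF ?; rewrite derive1E; exact: derive_val.
have := continuous_FTC2 (gtrN (@ltr01 R)) (continuous_subspaceT cf) dFLR dFf.
have v0 s : s ^+ 2 = 1 -> F s = 0 by move=> s1; rewrite /F /v s1 subrr sqrtr0 expr0n mul0r.
rewrite !v0 ?sqrrN ?expr1n// subee// => /(congr1 fine)/=.
rewrite -/(Rintegral _ _ _) RintegralB//; last 2 first.
- by apply: continuous_integrable_itv; apply: continuousMfun => //; move=> ?; exact: cst_continuous.
- by apply: continuous_integrable_itv; apply: continuousMfun => //; move=> ?; exact: cst_continuous.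
rewrite !RintegralZl//; last 2 first.
- exact: continuous_integrable_itv.
- exact: continuous_integrable_itv.
move=> /eqP; rewrite subr_eq0 => /eqP <-; congr (_ * _).
rewrite /A /cosint -RintegralB//; last 2 first.
- by apply: continuous_integrable_itv; apply: continuousMfun => //; exact: continuous_cosM.
- by apply: continuous_integrable_itv; apply: continuousMfun => //; exact: continuous_cosM.
apply: eq_Rintegral => s; rewrite inE/= in_itv/= -ler_norml => s1.
(* This identity turns the integral of [v s * cos (t * s)] into the difference of the two cosine
   integrals on the left-hand side. *)
have -> : v s = (1 - s ^+ 2) * w s.
  rewrite /v /w (exprD _ 2 p) sqr_sqrtr// subr_ge0 -[s ^+ 2]real_normK ?num_real//.
  by rewrite expr_le1.
by ring.
Qed.

(* With [n = p + 2], [A' = - B] and [B' = A - n B / t]; this is the energy of the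
   corresponding second order equation, corrected so that its derivative is
   [O(1 / t^2)] times itself. *)
Let F2 (t : R) : R := t ^+ n * (A t ^+ 2 + B t ^+ 2) - n%:R * t ^+ p.+1 * A t * B t.

Let dA (t : R) : is_derive t (1 : R) A (- B t). Proof. exact: is_derive_cosint. Qed.

Let dB (t : R) : t != 0 -> is_derive t (1 : R) B (A t - n%:R / t * B t).
Proof.
move=> t0; refine (is_derive_eq (is_derive_sinint _ csw) _).
have := cosint_by_parts t => e.
rewrite [_ / _ * _]mulrAC -e; field => //.
Qed.

(** The derivative of [t^n (A^2 + B^2)] is [n t^(n-1) (A^2 - B^2)]. The correction term cancels it
    exactly and leaves a remainder two powers of [t] below the energy. *)
Let dF2 (t : R) : t != 0 -> is_derive t (1 : R) F2 (n%:R * t ^+ p * A t * B t).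
Proof.
move=> t0.
have dX k : is_derive t (1 : R) (fun x : R => x ^+ k) (k%:R * t ^+ k.-1).
  have := @is_deriveX _ _ (@id R) k t 1 _ (is_derive_id _ _).
  by rewrite exprfctE scaleE mulr1.
have dAA := is_deriveM (dA t) (dA t); have dBB := is_deriveM (dB t0) (dB t0).
have d1 := is_deriveM (dX n) (is_deriveD dAA dBB).
have d2 := is_deriveM (is_deriveM (@is_deriveZ _ _ _ _ n%:R _ _ _ (dX p.+1)) (dA t)) (dB t0).
refine (is_derive_eq (is_deriveB d1 d2) _).
rewrite !scaleE /= -[(A * A + B * B) t]/(A t * A t + B t * B t).
rewrite -[(_ * A) t]/(n%:R * t ^+ p.+1 * A t) -[n%:R *: t ^+ p.+1]/(n%:R * t ^+ p.+1).
by rewrite !exprS; field.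
Qed.

(** For [t >= t0] the energy [F2] controls [t^n A^2] and, up to the factor [1 + n / t], does not
    increase, so its value at [t0] bounds it. For [t <= t0] the trivial bound of [A] by the integral
    of [|w|] suffices. *)
Lemma cosint_half_disk_bound : exists2 K : R, 0 < K &
  forall t, 0 <= t -> cosint (fun s => Num.sqrt (1 - s ^+ 2) ^+ p) t ^+ 2 <= K /\
    t ^+ n * cosint (fun s => Num.sqrt (1 - s ^+ 2) ^+ p) t ^+ 2 <= K.
Proof.
have n0 : 0 < n%:R :> R by rewrite ltr0n.
(* The condition [t >= 2 n] gives [(1 + 2 n / t) A B <= A^2 + B^2], which is what [F2_deriv_ub]
   amounts to. *)
pose t0 : R := 2 * n%:R.
have t00 : 0 < t0 by rewrite mulr_gt0.
pose S t := A t ^+ 2 + B t ^+ 2.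
have S0 t : 0 <= S t by rewrite addr_ge0 ?sqr_ge0.
have F2_lb t : t0 <= t -> t ^+ n * S t <= 2 * F2 t.
  move=> tt0; have tp : 0 < t by exact: lt_le_trans tt0.
  rewrite -subr_ge0 (_ : _ - _ = t ^+ p.+1 *
      ((t - t0) * S t + n%:R * (S t + (A t - B t) ^+ 2))); last first.
    by rewrite /F2 /S /t0 !exprS; ring.
  rewrite mulr_ge0 ?exprn_ge0 ?(ltW tp)// addr_ge0// mulr_ge0 ?subr_ge0 ?(ltW n0)//.
  by rewrite addr_ge0 ?sqr_ge0.
have F2_deriv_ub t : t0 <= t ->
    n%:R * t ^+ p * A t * B t * (1 + n%:R / t) <= n%:R / t ^+ 2 * F2 t.
  move=> tt0; have tp : 0 < t by exact: lt_le_trans tt0.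
  have tn0 : t != 0 by rewrite gt_eqF.
  rewrite -subr_ge0 (_ : _ - _ = n%:R * t ^+ p * t^-1 *
      ((t - t0) / 2 * S t + (t + t0) / 2 * (A t - B t) ^+ 2)); last first.
    by rewrite /F2 /S /t0 !exprS; field.
  rewrite mulr_ge0// ?(mulr_ge0, invr_ge0, exprn_ge0) ?(ltW tp) ?(ltW n0)//.
  rewrite addr_ge0// mulr_ge0 ?sqr_ge0 ?divr_ge0 ?subr_ge0//.
  by rewrite addr_ge0// ltW.
(* An integrating factor: the derivative of [1 + n / t] is [- n / t^2], so [F2_deriv_ub] says that
   the derivative of [G] is nonpositive. *)
pose G t := F2 t * (1 + n%:R * t^-1).
have dG (t : R) : 0 < t -> is_derive t (1 : R) G
    (n%:R * t ^+ p * A t * B t * (1 + n%:R / t) - n%:R / t ^+ 2 * F2 t).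
  move=> tp; have tn0 : t != 0 by rewrite gt_eqF.
  have dV : is_derive t (1 : R) (fun x : R => x^-1) (- t ^- 2).
    by have := @is_deriveV _ (@id R) t 1 1 tn0 (is_derive_id _ _); rewrite scaleE mulr1.
  have dc : is_derive t (1 : R) (fun x : R => 1 + n%:R * x^-1) (0 + n%:R * (- t ^- 2)).
    have dV' := @is_deriveZ _ _ _ _ n%:R _ _ _ dV.
    have dc1 : is_derive t (1 : R) (cst (1 : R)) (0 : R) by exact: is_derive_cst.
    have := is_deriveD dc1 dV'. exact.
  refine (is_derive_eq (is_deriveM (dF2 tn0) dc) _).
  by rewrite !scaleE; ring.
have G_noninc t : t0 <= t -> G t <= G t0.
  apply: (@ler0_derive1_nincry _ G t0) => //.
  - move=> x; rewrite in_itv/= andbT => tx.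
    by have [] := dG x (lt_trans t00 tx).
  - move=> x; rewrite in_itv/= andbT => tx.
    rewrite derive1E (@derive_val _ _ _ _ _ _ _ (dG x (lt_trans t00 tx))).
    by rewrite subr_le0 F2_deriv_ub// ltW.
  - apply: derivable_within_continuous => x; rewrite in_itv/= andbT => tx.
    by have [] := dG x (lt_le_trans t00 tx).
pose m := \int[mu]_(s in I) `|w s|.
have m0 : 0 <= m by apply: Rintegral_ge0 => s _; exact: normr_ge0.
have Am t : A t ^+ 2 <= m ^+ 2.
  rewrite -[A t ^+ 2]real_normK ?num_real// ler_pXn2r ?nnegrE//.
  have ci : mu.-integrable I (EFin \o (fun s => w s * cos (t * s))).
    by apply: continuous_integrable_itv; apply: continuousMfun => //; exact: continuous_cosM.
  apply: (le_trans (le_normr_Rintegral _ ci)) => //.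
  apply: le_Rintegral => //.
  - exact: (integrable_norm ci).
  - by apply: (@integrable_norm _ _ _ mu I w); exact: continuous_integrable_itv.
  - by move=> s _; rewrite normrM ler_piMr// ler_norml cos_geN1 cos_le1.
have F20 t : t0 <= t -> 0 <= F2 t.
  move=> tt0; rewrite -(pmulr_rge0 _ (@ltr0Sn R 1)) (le_trans _ (F2_lb _ tt0))//.
  by apply: mulr_ge0 => //; apply: exprn_ge0; exact: le_trans (ltW t00) tt0.
have G00 : 0 <= G t0.
  by rewrite mulr_ge0 ?F20// addr_ge0// mulr_ge0 ?invr_ge0 ?(ltW n0) ?(ltW t00).
have : 0 <= t0 ^+ n * m ^+ 2 by rewrite mulr_ge0 ?exprn_ge0 ?(ltW t00).
have := sqr_ge0 m; move: Am G00 G_noninc; set g0 := G t0.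
set m2 := m ^+ 2; set c := t0 ^+ n * m2 => Am G00 G_noninc mm0 tm0.
(* [m2] bounds [A^2] everywhere, [c] serves for [t < t0], [2 * g0] for [t >= t0], and 1 makes the
   constant positive. *)
exists (m2 + c + 2 * g0 + 1); first by lra.
move=> t tp; rewrite -/(A t); split.
  by have := Am t; lra.
have [tt0|tt0] := leP t0 t.
  have h1 : t ^+ n * A t ^+ 2 <= 2 * F2 t.
    apply: le_trans (F2_lb _ tt0); rewrite ler_wpM2l ?exprn_ge0//.
    by rewrite lerDl sqr_ge0.
  have h2 : F2 t <= G t.
    by rewrite ler_peMr ?F20// lerDl mulr_ge0 ?invr_ge0 ?(ltW n0) ?tp.
  by have := G_noninc _ tt0; lra.
have : t ^+ n * A t ^+ 2 <= c.
  by apply: ler_pM => //; rewrite ?sqr_ge0 ?exprn_ge0 ?lerXn2r ?nnegrE// ltW.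
by lra.
Qed.

End trigonometric_integral.

(** * The Fourier transform of the indicator function of a ball *)

Section ball_fourier.
Context {R : realType}.
Local Notation leb := (@lebesgue_measure R).
Local Notation lam d := (lebesgue_rV d : {measure set 'rV[R]_d -> \bar R}).

Lemma ge0_integral_rV_cons d (f : 'rV[R]_d.+1 -> \bar R) :
  measurable_fun setT f -> (forall x, 0 <= f x)%E ->
  (\int[lam d.+1]_x f x =
   \int[leb]_s \int[lam d]_v f (rV_cons (s, v)))%E.
Proof.
move=> mf f0.
pose T := (measurableTypeR R * 'rV[R]_d)%type.
have mc : measurable_fun [set: T] (@rV_cons R d : T -> 'rV[R]_d.+1).
  exact: measurable_rV_cons.
transitivity (\int[(leb \x lebesgue_rV d)%E]_z f (@rV_cons R d z))%E.
  apply: (@ge0_integral_pushforward _ _ T _ R _ mc (leb \x lebesgue_rV d)%E setT f) => //.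
apply: (@fubini_tonelli1 _ _ _ _ _ leb (lebesgue_rV d) (f \o @rV_cons R d)).
  by apply: measurableT_comp => //; exact: measurable_rV_cons.
by move=> x; exact: f0.
Qed.

Lemma ge0_integral_rV_scale d (r : R) (f : 'rV[R]_d -> \bar R) : 0 < r ->
  measurable_fun setT f -> (forall x, 0 <= f x)%E ->
  (\int[lam d]_x f x = (r ^+ d)%:E * \int[lam d]_x f (r *: x)%R)%E.
Proof.
move=> r0 mf f0.
have mr : measurable_fun setT ( *:%R r : 'rV[R]_d -> 'rV[R]_d) by exact: measurable_mxZ.
have rd0 : 0 <= (r ^+ d)^-1 by rewrite invr_ge0 exprn_ge0// ltW.
have rd : r ^+ d != 0 by rewrite gt_eqF// exprn_gt0.
rewrite -[in RHS](@ge0_integral_pushforward _ _ _ _ R _ mr (lam d) setT f)//.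
rewrite [in RHS](eq_measure_integral (mscale (NngNum rd0) (lam d))); last first.
  move=> A mA _; transitivity ((r ^+ d)^-1%:E * lebesgue_rV d A)%E; last by [].
  by rewrite (lebesgue_rV_scale r0 mA) muleA -EFinM mulVf// mul1e.
by rewrite ge0_integral_mscale//= muleA -EFinM divff// mul1e.
Qed.

Definition eball_volume d : R := fine (lebesgue_rV d (@eball R d 1)).

Lemma eball_volumeE d : (lebesgue_rV d (@eball R d 1) = (eball_volume d)%:E)%E.
Proof. by rewrite fineK// ge0_fin_numE// lebesgue_rV_eball_lty. Qed.

Lemma eball_volume_gt0 d : 0 < eball_volume d.
Proof. by rewrite -lte_fin -eball_volumeE lebesgue_rV_eball_gt0. Qed.

Lemma dotrV_cons d (s : R) (v : 'rV[R]_d) :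
  dotrV (rV_cons (s, v)) (rV_cons (s, v)) = s ^+ 2 + dotrV v v.
Proof.
rewrite /dotrV big_ord_recl !rV_cons0 -expr2; congr (_ + _).
by apply: eq_bigr => i _; rewrite !rV_consS.
Qed.

(** This includes [|s| >= 1]: the square root of a negative number is 0, and the open ball of radius
    0 is empty. *)
Lemma eball_section d (s : R) :
  [set v : 'rV[R]_d | eball 1 (rV_cons (s, v))] = eball (Num.sqrt (1 - s ^+ 2)).
Proof.
have sqrt_lt (x y : R) : 0 <= x -> (Num.sqrt x < Num.sqrt y) = (x < y).
  move=> x0; have [y0|y0] := leP y 0; last by rewrite ltr_sqrt.
  rewrite (ler0_sqrtr y0) ltNge sqrtr_ge0; apply/esym/negbTE; rewrite -leNgt.
  exact: le_trans x0.
have eqv v : (Num.sqrt (s ^+ 2 + dotrV v v) < 1) =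
    (Num.sqrt (dotrV v v) < Num.sqrt (1 - s ^+ 2)) :> bool.
  rewrite -{1}[1]sqrtr1 !sqrt_lt ?addr_ge0 ?sqr_ge0 ?dotrV_ge0//.
  by rewrite ltrBrDl.
by apply/seteqP; split => v; rewrite /eball /= dotrV_cons eqv.
Qed.

(* At [s = +-1] the slice is empty whereas [0 ^+ 0 = 1] when [d = 0], hence the
   open interval. *)
Lemma lebesgue_eball_section d (s : R) :
  (lebesgue_rV d (@eball R d (Num.sqrt (1 - s ^+ 2))) =
   (\1_(`]-1, 1[%classic) s * (eball_volume d * Num.sqrt (1 - s ^+ 2) ^+ d))%:E)%E.
Proof.
have s1E : (s \in `]-1, 1[) = (0 < 1 - s ^+ 2).
  rewrite in_itv/= -ltr_norml subr_gt0 -[s ^+ 2]real_normK ?num_real//.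
  by rewrite expr_lt1.
rewrite indicE mem_setE s1E; case: ltP => s1.
  by rewrite mul1r mulrC EFinM -eball_volumeE lebesgue_rV_eball ?sqrtr_gt0.
rewrite mul0r ler0_sqrtr// (_ : eball 0 = set0) ?measure0//.
by apply/seteqP; split => // v; rewrite eballE /= ltNge enorm_ge0.
Qed.

Lemma indic_eball d (r : R) (x : 'rV[R]_d) :
  \1_(eball r) x = (enorm x < r)%R%:R :> R.
Proof.
rewrite indicE (_ : (x \in eball r) = (enorm x < r))//.
by apply/idP/idP => [/set_mem|?]//; exact/mem_set.
Qed.

(** A dilation reduces to the unit ball, and the isometry of [exists_isometry] turns [dotrV x xi]
    into [enorm xi] times the first coordinate. Slicing along that coordinate leaves balls of radius
    [sqrt (1 - s^2)] on which the factor [h] is constant. *)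
Lemma ge0_integral_eball_dotrV d (r : R) (xi : 'rV[R]_d.+1) (h : R -> R) :
  0 < r -> continuous h -> (forall s, 0 <= h s) ->
  (\int[lam d.+1]_x (\1_(eball r) x * h (dotrV x xi))%:E =
   (r ^+ d.+1 * eball_volume d)%:E * \int[leb]_(s in `[(-1)%R, 1%R])
     (Num.sqrt (1 - s ^+ 2) ^+ d * h (r * enorm xi * s))%:E)%E.
Proof.
move=> r0 ch h0.
have mh : measurable_fun setT h by exact: continuous_measurable_fun.
have mB s : measurable_fun setT (\1_(eball s) : 'rV[R]_d.+1 -> R).
  by apply: measurable_indic; exact: measurable_eball.
have mI : measurable_fun setT (fun x => (\1_(eball r) x * h (dotrV x xi))%:E).
  apply/measurable_EFinP; apply: measurable_funM => //.
  by apply: (measurableT_comp mh); exact: measurable_dotrV.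
rewrite (ge0_integral_rV_scale r0)//; last by move=> x; rewrite lee_fin mulr_ge0.
rewrite EFinM -muleA; congr (_ * _)%E.
have [H [mH lH eH dH]] := exists_isometry xi.
pose g (x : 'rV[R]_d.+1) := (\1_(eball 1) x * h (r * dotrV x xi))%:E.
transitivity (\int[lam d.+1]_x g x)%E.
  apply: eq_integral => x _; rewrite /g dotrVZl; congr (_ * _)%:E.
  by rewrite !indic_eball enormZ gtr0_norm// -ltr_pdivlMl// mulVf ?gt_eqF.
have mg : measurable_fun setT g.
  apply/measurable_EFinP; apply: measurable_funM => //.
  apply: (measurableT_comp mh); apply: measurable_funM => //.
  exact: measurable_dotrV.
rewrite -(ge0_integral_measure_preserving mH lH mg); last by move=> x; rewrite lee_fin mulr_ge0.
pose g1 (x : 'rV[R]_d.+1) := (\1_(eball 1) x * h (r * enorm xi * x 0 ord0))%:E.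
transitivity (\int[lam d.+1]_x g1 x)%E.
  by apply: eq_integral => x _; rewrite /g /g1 dH mulrA !indic_eball eH.
rewrite ge0_integral_rV_cons; last 2 first.
- apply/measurable_EFinP; apply: measurable_funM => //.
  apply: (measurableT_comp (f := h)) => //; apply: measurable_funM => //.
  exact: measurable_coord.
- by move=> x; rewrite lee_fin mulr_ge0.
pose k s := (Num.sqrt (1 - s ^+ 2) ^+ d * h (r * enorm xi * s)).
have ck : continuous k.
  apply: continuousMfun; first exact: continuous_half_disk.
  by move=> s; apply: continuous_comp; [exact: mulrl_continuous|exact: ch].
have k0 s : 0 <= k s by rewrite mulr_ge0// exprn_ge0// sqrtr_ge0.
have mk : measurable_fun setT (fun s => (k s)%:E).
  by apply/measurable_EFinP; exact: continuous_measurable_fun.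
transitivity (\int[leb]_(s in `](-1)%R, 1%R[) ((eball_volume d)%:E * (k s)%:E))%E.
  rewrite [RHS]integral_mkcond; apply: eq_integral => s _.
  transitivity ((h (r * enorm xi * s))%:E * lebesgue_rV d (@eball R d (Num.sqrt (1 - s ^+ 2))))%E.
    rewrite -eball_section.
    have mS : measurable [set v : 'rV[R]_d | eball 1 (rV_cons (s, v))].
      by rewrite eball_section; exact: measurable_eball.
    have := @integral_indic _ _ _ (lam d) _ measurableT _ mS; rewrite setIT => <-.
    have m1 : measurable_fun setT
        (fun v => (\1_[set v : 'rV[R]_d | eball 1 (rV_cons (s, v))] v)%:E : \bar R).
      by apply/measurable_EFinP; exact: measurable_indic.
    rewrite -[RHS](ge0_integralZl _ measurableT m1) ?lee_fin//.
    by apply: eq_integral => v _; rewrite /g1 rV_cons0 -EFinM mulrC.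
  rewrite lebesgue_eball_section patchE indicE -EFinM.
  by case: ifPn => _; rewrite ?mul1r ?mul0r ?mulr0// /k -EFinM; congr _%:E; ring.
rewrite ge0_integralZl//; last 3 first.
- exact: measurable_funS mk.
- by move=> s _; rewrite lee_fin.
- by rewrite lee_fin ltW// eball_volume_gt0.
congr (_ * _)%E.
(* The endpoints form a null set, so the interval may be closed again. *)
rewrite integral_itv_bndo_bndc ?integral_itv_obnd_cbnd//.
- exact: measurable_funS mk.
- exact: measurable_funS mk.
Qed.

End ball_fourier.

(** * Explicit transform of a ball, with its upper and lower bounds *)

Section ball_fourier_bounds.
Context {R : realType} {d : nat}.
Local Open Scope complex_scope.
Local Notation leb := (@lebesgue_measure R).
Local Notation lam := (lebesgue_rV d.+1 : {measure set 'rV[R]_d.+1 -> \bar R}).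
Local Notation w := (fun s : R => Num.sqrt (1 - s ^+ 2) ^+ d).
Implicit Types (r : R) (xi : 'rV[R]_d.+1) (h : R -> R).

Definition ball_indicator (n : nat) (r : R) (x : 'rV[R]_n) : R[i] := (\1_(eball r) x : R)%:C.

Lemma integrable_eball_dotrV r xi h : continuous h -> (forall s, `|h s| <= 1) ->
  lam.-integrable setT (fun x => (\1_(eball r) x * h (dotrV x xi))%:E).
Proof.
move=> ch h1.
have mB : measurable_fun setT (\1_(eball r) : 'rV[R]_d.+1 -> R).
  by apply: measurable_indic; exact: measurable_eball.
have iB : lam.-integrable setT (EFin \o (\1_(eball r) : 'rV[R]_d.+1 -> R)).
  apply/integrableP; split; first exact/measurable_EFinP.
  rewrite (eq_integral (fun x => (\1_(eball r) x : R)%:E)); last first.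
    by move=> x _ /=; rewrite ger0_norm.
  rewrite integral_indic//; last exact: measurable_eball.
  by rewrite setIT; exact: lebesgue_rV_eball_lty.
apply: le_integrable iB => //.
  apply/measurable_EFinP; apply: measurable_funM => //.
  apply: (measurableT_comp (f := h)); first exact: continuous_measurable_fun.
  exact: measurable_dotrV.
by move=> x _ /=; rewrite lee_fin normrM ler_piMr.
Qed.

Lemma Rintegral_eball_dotrV_ge0 r xi h : 0 < r -> continuous h -> (forall s, 0 <= h s) ->
  \int[lam]_x (\1_(eball r) x * h (dotrV x xi)) = r ^+ d.+1 * eball_volume d *
    \int[leb]_(s in `[-1, 1]) (w s * h (r * enorm xi * s)).
Proof.
move=> r0 ch h0; rewrite /Rintegral ge0_integral_eball_dotrV// fineM//.
apply: integrable_fin_num => //.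
apply: continuous_integrable_itv; apply: continuousMfun; first exact: continuous_half_disk.
by move=> s; apply: continuous_comp; [exact: mulrl_continuous|exact: ch].
Qed.

(** For [h] of either sign, apply the nonnegative case to [1 + h] and to 1, and subtract. *)
Lemma Rintegral_eball_dotrV r xi h : 0 < r -> continuous h -> (forall s, `|h s| <= 1) ->
  \int[lam]_x (\1_(eball r) x * h (dotrV x xi)) = r ^+ d.+1 * eball_volume d *
    \int[leb]_(s in `[-1, 1]) (w s * h (r * enorm xi * s)).
Proof.
move=> r0 ch h1.
have c1 : continuous (fun _ : R => 1 : R) by move=> ?; exact: cst_continuous.
have ch1 : continuous (fun s => 1 + h s).
  by move=> s; apply: cvgD; [exact: c1|exact: ch].
have h0 s : 0 <= 1 + h s by have := h1 s; rewrite ler_norml => /andP[? _]; lra.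
have chM : continuous (fun s : R => h (r * enorm xi * s)).
  by move=> s; apply: continuous_comp; [exact: mulrl_continuous|exact: ch].
have := Rintegral_eball_dotrV_ge0 xi r0 ch1 h0.
have := Rintegral_eball_dotrV_ge0 xi r0 c1 (fun _ => ler01).
have -> : (fun x => \1_(eball r) x * (1 + h (dotrV x xi))) =
  (fun x => \1_(eball r) x * 1 + \1_(eball r) x * h (dotrV x xi)).
  by apply/funext => x; rewrite mulrDr.
have -> : (fun s : R => w s * (1 + h (r * enorm xi * s))) =
  (fun s : R => w s * 1 + w s * h (r * enorm xi * s)).
  by apply/funext => x; rewrite mulrDr.
rewrite RintegralD//; last 2 first.
- by apply: (@integrable_eball_dotrV r xi (fun=> 1)) => // ?; rewrite normr1.
- exact: integrable_eball_dotrV.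
rewrite [in X in _ -> X -> _]RintegralD//; last 2 first.
- by apply: continuous_integrable_itv; apply: continuousMfun => //; exact: continuous_half_disk.
- by apply: continuous_integrable_itv; apply: continuousMfun => //; exact: continuous_half_disk.
by move=> ->; rewrite mulrDr => /addrI.
Qed.

Lemma fourier_ball_indicator r xi : 0 < r ->
  fourier (@ball_indicator d.+1 r) xi =
  (r ^+ d.+1 * eball_volume d * cosint w (2 * pi * (r * enorm xi)))%:C.
Proof.
move=> r0; rewrite /fourier /cintegral.
pose cs (t : R) := cos (2 * pi * t).
pose sn (t : R) := sin (2 * pi * t).
have ccs : continuous cs by exact: continuous_cosM.
have csn : continuous sn by exact: continuous_sinM.
have cs1 s : `|cs s| <= 1 by rewrite ler_norml cos_geN1 cos_le1.
have sn1 s : `|sn s| <= 1 by rewrite ler_norml sin_geN1 sin_le1.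
rewrite (_ : (fun x => complex.Re _) = (fun x => \1_(eball r) x * cs (dotrV x xi))); last first.
  by apply/funext => x /=; rewrite mul0r subr0 cosN.
rewrite (_ : (fun x => complex.Im _) =
    (fun x => - 1 * (\1_(eball r) x * sn (dotrV x xi)))); last first.
  by apply/funext => x /=; rewrite mul0r addr0 sinN mulrN mulN1r.
rewrite RintegralZl//; last exact: integrable_eball_dotrV.
(* This integral is odd in [xi], yet by the slicing formula it depends on [xi] only through
   [enorm xi]; hence it is 0. *)
have sn0 : \int[lam]_x (\1_(eball r) x * sn (dotrV x xi)) = 0.
  have : \int[lam]_x (\1_(eball r) x * sn (dotrV x (- xi))) =
      - 1 * \int[lam]_x (\1_(eball r) x * sn (dotrV x xi)).
    rewrite -RintegralZl//; last exact: integrable_eball_dotrV.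
    by apply: eq_Rintegral => x _; rewrite dotrVC dotrVNl dotrVC /sn mulrN sinN mulrN mulN1r.
  by rewrite !Rintegral_eball_dotrV// enormN => ?; lra.
rewrite sn0 mulr0 Rintegral_eball_dotrV//; congr (_ +i* _); congr (_ * _).
by apply: eq_Rintegral => s _; rewrite /cs !mulrA.
Qed.

Lemma sqnormc_fourier_ball_indicator r xi : 0 < r ->
  sqnormc (fourier (@ball_indicator d.+1 r) xi) =
  r ^+ (d.+1).*2 * (eball_volume d * cosint w (2 * pi * (r * enorm xi))) ^+ 2.
Proof.
move=> r0; rewrite fourier_ball_indicator// /sqnormc /= expr0n addr0.
by rewrite -mulrA exprMn -exprM muln2.
Qed.

Let integrable_cosint t : leb.-integrable `[-1, 1] (EFin \o (fun s => w s * cos (t * s))).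
Proof.
apply: continuous_integrable_itv; apply: continuousMfun; first exact: continuous_half_disk.
exact: continuous_cosM.
Qed.

(** Here [|t * s| <= 1 < pi], and cosine is even and decreasing on [[0, pi]], so
    [cos (t * s) >= cos 1] throughout the integral. *)
Lemma cosint_half_disk_lb (t : R) : 0 <= t <= 1 -> cos 1 * cosint w 0 <= cosint w t.
Proof.
move=> /andP[t0 t1]; rewrite /cosint -RintegralZl//.
apply: le_Rintegral => //.
- have := integrable_cosint 0 => /(@integrableZl _ _ _ leb _ (measurable_itv _) (cos 1) _).
  exact.
- move=> s; rewrite /= in_itv/= -ler_norml => s1; rewrite mul0r cos0 mulr1 mulrC.
  rewrite ler_wpM2l ?exprn_ge0 ?sqrtr_ge0//.
  rewrite -[X in _ <= X]cos_norm normrM ger0_norm//.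
  have pi2 := pi_ge2 R.
  have ts : t * `|s| <= 1 by rewrite mulr_ile1.
  rewrite leNgt; apply/negP; rewrite ltr_cos ?in_itv/= ?mulr_ge0//=; lra.
Qed.

(** By the slicing formula with [h = 1], this number is the ratio of the volumes of the unit balls
    in dimensions [d.+1] and [d]. *)
Lemma cosint_half_disk_gt0 : 0 < cosint w 0.
Proof.
have c1 : continuous (fun _ : R => 1 : R) by move=> ?; exact: cst_continuous.
have := @Rintegral_eball_dotrV_ge0 1 0 (fun=> 1) ltr01 c1 (fun _ => ler01).
rewrite (_ : (fun x => _) = \1_(eball 1)); last by apply/funext => x; rewrite mulr1.
rewrite {1}/Rintegral integral_indic//; last exact: measurable_eball.
rewrite setIT -/(eball_volume d.+1) expr1n mul1r.
have -> : \int[leb]_(s in `[-1, 1]) (w s * 1) = cosint w 0.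
  by apply: eq_Rintegral => s _; rewrite mul0r cos0.
have V1 := @eball_volume_gt0 R d.+1; have V0 := @eball_volume_gt0 R d => e.
by move: V1; rewrite e pmulr_rgt0.
Qed.

(** The bounds serve low frequencies, all frequencies and high frequencies in turn. They come from
    [cosint_half_disk_lb], from the boundedness of [cosint] and from its decay; the last passes from
    [t] to [r * enorm xi] because [2 * pi >= 1]. *)
Lemma fourier_ball_bounds : exists K c : R, [/\ 0 < K, 0 < c &
  forall r xi, 0 < r ->
  let F := sqnormc (fourier (@ball_indicator d.+1 r) xi) in
  [/\ 2 * pi * (r * enorm xi) <= 1 -> c * r ^+ (d.+1).*2 <= F,
      F <= K * r ^+ (d.+1).*2 &
      (r * enorm xi) ^+ d.+2 * F <= K * r ^+ (d.+1).*2]].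
Proof.
have [K K0 AK] := @cosint_half_disk_bound R d.
have V0 := @eball_volume_gt0 R d.
exists (eball_volume d ^+ 2 * K), ((eball_volume d * (cos 1 * cosint w 0)) ^+ 2).
split.
- by rewrite mulr_gt0// exprn_gt0.
- by rewrite exprn_gt0// !mulr_gt0// ?cos1_gt0// cosint_half_disk_gt0.
move=> r xi r0; rewrite /= sqnormc_fourier_ball_indicator//.
set rd := r ^+ _; have rd0 : 0 < rd by rewrite exprn_gt0.
set t := 2 * pi * _.
have rxi0 : 0 <= r * enorm xi by rewrite mulr_ge0 ?enorm_ge0// ltW.
have pi2 : 1 <= 2 * pi :> R by have := pi_ge2 R; lra.
have t0 : 0 <= t by rewrite mulr_ge0// (le_trans ler01).
have [At1 At2] := AK t t0.
split.
- move=> t1; rewrite mulrC ler_wpM2l// ?(ltW rd0)//.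
  have A0 : 0 < cos 1 * cosint w 0 by rewrite mulr_gt0 ?cos1_gt0// cosint_half_disk_gt0.
  have A1 : cos 1 * cosint w 0 <= cosint w t by rewrite cosint_half_disk_lb// t0.
  have VA : eball_volume d * (cos 1 * cosint w 0) <= eball_volume d * cosint w t.
    by rewrite ler_wpM2l// ltW.
  have VA0 := ltW (mulr_gt0 V0 A0).
  by rewrite lerXn2r ?nnegrE// (le_trans VA0).
- by rewrite mulrC ler_wpM2r ?(ltW rd0)// exprMn ler_wpM2l// exprn_ge0// ltW.
rewrite mulrCA mulrC ler_wpM2r ?(ltW rd0)//.
rewrite (exprMn _ (eball_volume d)) mulrCA ler_wpM2l ?exprn_ge0 ?(ltW V0)//.
apply: le_trans At2; rewrite ler_wpM2r ?sqr_ge0// lerXn2r ?nnegrE//.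
by rewrite /t ler_peMl.
Qed.

End ball_fourier_bounds.

(** * Number of points in balls *)

Lemma bounded_subset {R : realType} {d : nat} (A B : set 'rV[R]_d) :
  A `<=` B -> bounded_set B -> bounded_set A.
Proof.
move=> AB [M [Mr BM]]; exists M; split => // x Mx y Ay.
exact: BM Mx y (AB _ Ay).
Qed.

Section counting_points.
Context {R : realType} {d : nat} {disp : measure_display}.
Context {Omega : measurableType disp}.
Context (P : probability Omega R) (Lambda : Omega -> set 'rV[R]_d).
Context (lfL : forall w, locally_finite (Lambda w)).
Implicit Types (B C : set 'rV[R]_d) (w : Omega).

Lemma npoints_card B w : bounded_set B ->
  npoints Lambda B w = (#|` fset_set (Lambda w `&` B)|)%:R.
Proof. by move=> bB; rewrite /npoints /counting asboolT//; exact: lfL. Qed.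

Lemma npoints_ge0 B w : 0 <= npoints Lambda B w.
Proof. by rewrite fine_ge0// /counting; case: ifP. Qed.

(** Counts in several subsets of [C] become sums over one finite set of points, so that they can be
    added and compared pointwise. *)
Lemma npoints_sum B C w : bounded_set C -> B `<=` C ->
  npoints Lambda B w = \sum_(x <- fset_set (Lambda w `&` C)) \1_B x.
Proof.
move=> bC BC; have bB : bounded_set B by exact: bounded_subset bC.
have fB := lfL w bB; have fC := lfL w bC.
rewrite npoints_card// -sum1_size natr_sum.
rewrite (eq_big_seq (\1_B : _ -> R)); last first.
  by move=> x; rewrite in_fset_set// inE => -[_ Bx]; rewrite indicE mem_set.
apply: big_fset_incl.
  apply/fsubsetP => x; rewrite !in_fset_set// !inE => -[Lx Bx]; split => //; exact: BC.
move=> x; rewrite !in_fset_set// inE => -[Lx Cx] xB.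
rewrite indicE; case: (boolP (x \in B)) => // /set_mem Bx.
by move/negP : xB; case; exact/mem_set.
Qed.

Lemma linear_statistic_ball_indicator (r : R) w :
  linear_statistic Lambda (ball_indicator r) w = (npoints Lambda (eball r) w)%:C%C.
Proof.
have bB := @bounded_eball R d r; have fB := lfL w bB.
rewrite /linear_statistic npoints_card// -sum1_size natr_sum.
rewrite -(fsbig_widen (Lambda w `&` eball r)); last 2 first.
- by move=> x [].
- move=> x [Lx /= nB]; rewrite /ball_indicator indicE memNset// => Bx.
  exact: nB.
rewrite fsbig_finite// rmorph_sum; apply: eq_big_seq => x.
by rewrite in_fset_set// inE => -[_ Bx]; rewrite /ball_indicator indicE mem_set.
Qed.

Lemma cvariance_ball (r : R) :
  cvariance P (linear_statistic Lambda (ball_indicator r)) =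
  fine 'V_P[npoints Lambda (eball r)].
Proof.
rewrite /variance unlock /cvariance unlock /Rintegral; congr fine.
apply: eq_integral => w _; rewrite /sqnormc linear_statistic_ball_indicator.
rewrite /cintegral.
rewrite (_ : (fun x => complex.Im _) = cst 0); last first.
  by apply/funext => x; rewrite linear_statistic_ball_indicator.
rewrite (_ : (fun x => complex.Re _) = npoints Lambda (eball r)); last first.
  by apply/funext => x; rewrite linear_statistic_ball_indicator.
rewrite /Rintegral integral0/= subrr expr0n addr0 expr2.
by [].
Qed.

End counting_points.

Lemma test_function_ball_indicator {R : realType} d (r : R) :
  test_function (@ball_indicator R d r).
Proof.
have mB : measurable_fun setT (\1_(eball r) : 'rV[R]_d -> R).
  by apply: measurable_indic; exact: measurable_eball.
split.
- exact: mB.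
- exact: measurable_cst.
- exists 1 => x; rewrite /sqnormc /= expr0n addr0 indic_eball.
  by case: (_ < _); rewrite ?expr1n ?expr0n.
- apply: bounded_subset (@bounded_eball R d r) => x /=.
  rewrite /ball_indicator indic_eball eballE /=.
  by case: (_ < _) => //; rewrite eqxx.
Qed.

(** * Stationarity and a packing argument for small balls *)

Section packing.
Context {R : realType} {d : nat} {disp : measure_display}.
Context {Omega : measurableType disp} (P : probability Omega R).
Context (T : 'rV[R]_d -> Omega -> Omega) (Lambda : Omega -> set 'rV[R]_d).
Context (aT : pmp_action P T) (ppL : invariant_point_process T Lambda).
Context (sqL : locally_square_integrable P Lambda).

Let lfL := pp_locally_finite ppL.

Lemma npoints_translate (x : 'rV[R]_d) (B : set 'rV[R]_d) w : bounded_set B ->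
  bounded_set [set x + y | y in B] ->
  npoints Lambda [set x + y | y in B] w = npoints Lambda B (T (- x) w).
Proof.
move=> bB bxB; rewrite !npoints_card//.
have -> : Lambda w `&` [set x + y | y in B] =
    [set x + y | y in Lambda (T (- x) w) `&` B].
  rewrite (pp_equivariant ppL); apply/seteqP; split => [z [Lz [y By yz]]|z [y [[u Lu uy] By] <-]].
    exists y => //; split => //; exists z => //.
    by rewrite -yz addKr.
  by split; [rewrite -uy addNKr|exists y].
rewrite fset_set_image; last exact: lfL.
by rewrite card_imfset//; exact: addrI.
Qed.

Lemma stationary_second_moment (x : 'rV[R]_d) (B : set 'rV[R]_d) :
  measurable B -> bounded_set B -> bounded_set [set x + y | y in B] ->
  (\int[P]_w ((npoints Lambda [set x + y | y in B] w) ^+ 2)%:E =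
   \int[P]_w ((npoints Lambda B w) ^+ 2)%:E)%E.
Proof.
move=> mB bB bxB.
have mN : measurable_fun setT (npoints Lambda B) by exact: (pp_measurable ppL).
rewrite -[RHS](@ge0_integral_measure_preserving _ _ _ P (T (- x))
  (fun w => ((npoints Lambda B w) ^+ 2)%:E)).
- by apply: eq_integral => w _; rewrite npoints_translate.
- have mp : measurable_fun setT (fun w : Omega => (- x, w)).
    by apply: measurable_fun_pair.
  exact: (measurableT_comp (action_measurable aT) mp).
- exact: action_preserving.
- by apply/measurable_EFinP; exact: measurable_funX.
- by move=> w; rewrite lee_fin sqr_ge0.
Qed.

Lemma sum_sqr_le (I : finType) (a : I -> R) : (forall i, 0 <= a i) ->
  \sum_i a i ^+ 2 <= (\sum_i a i) ^+ 2.
Proof.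
move=> a0; rewrite [leRHS]expr2 mulr_suml; apply: ler_sum => i _.
by rewrite expr2 ler_wpM2l// (bigD1 i)//= lerDl sumr_ge0.
Qed.

Lemma sum_indic_le1 (I : finType) (p : pred I) :
  (forall i j, p i -> p j -> i = j) -> \sum_i (p i)%:R <= 1 :> R.
Proof.
move=> pU; case: (pickP p) => [i pi|p0]; last first.
  by rewrite big1 ?ler01// => i _; rewrite p0.
rewrite (bigD1 i)//= pi big1 ?addr0// => j ji.
by case: (boolP (p j)) ji => // pj; rewrite (pU _ _ pj pi) eqxx.
Qed.

(* The unit cube contains [m ^ d] disjoint translates of the ball of radius
   [1 / (2 m)], up to a bounded enlargement. *)
Lemma small_ball_second_moment : exists2 C : R, 0 <= C &
  forall m : nat, (0 < m)%N ->
  ((m%:R ^+ d)%R%:E * \int[P]_w ((npoints Lambda (eball (2 * m%:R)^-1) w) ^+ 2)%:E <= C%:E)%E.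
Proof.
(* The centres of the translates lie in the unit cube and their radius is at most 1, so all of them
   stay inside [Q]. *)
pose Q : set 'rV[R]_d := [set v | forall i, `[-2, 2]%classic (v 0 i)].
have mQ : measurable Q by exact: measurable_cube.
have bQ : bounded_set Q.
  by apply: (bounded_coord (M := 2)) => v Qv i; have := Qv i; rewrite /= in_itv/= ler_norml.
have := sqL mQ bQ; set I := (\int[P]_w _)%E => Ioo.
have I0 : (0 <= I)%E by apply: integral_ge0 => w _; rewrite lee_fin sqr_ge0.
have Ifin : I \is a fin_num by rewrite ge0_fin_numE.
exists (fine I); first exact: fine_ge0.
move=> m m0; rewrite fineK//.
pose r : R := (2 * m%:R)^-1.
have m0' : 0 < m%:R :> R by rewrite ltr0n.
have r0 : 0 < r by rewrite invr_gt0 mulr_gt0.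
(* A grid of mesh [2 * r = 1 / m], with [m] positions in each coordinate. *)
pose pos (j : {ffun 'I_d -> 'I_m}) : 'rV[R]_d := \row_i (2 * r * (j i : nat)%:R).
pose B j := [set pos j + y | y in eball r].
have BE j x : B j x -> forall i, `|x 0 i - 2 * r * (j i : nat)%:R| < r.
  move=> [y yr <-] i; rewrite !mxE addrAC subrr add0r.
  by apply: le_lt_trans yr; exact: le_coord_enorm.
have BQ j : B j `<=` Q.
  move=> x /BE xr i; have := xr i; rewrite ltr_norml /= in_itv/= => /andP[x1 x2].
  have j0 : 0 <= 2 * r * (j i : nat)%:R by rewrite !mulr_ge0// ltW.
  have j1 : 2 * r * (j i : nat)%:R <= 1.
    rewrite /r invfM mulrA divff// mul1r mulrC ler_pdivrMr// mul1r ler_nat.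
    exact: ltnW.
  have r1 : r <= 1.
    rewrite invf_le1 ?mulr_gt0//.
    have : 1 <= m%:R :> R by rewrite ler1n.
    lra.
  lra.
have bB j : bounded_set (B j) by exact: bounded_subset bQ.
have mB j : measurable (B j).
  rewrite (_ : B j = (fun x => x - pos j) @^-1` eball r).
    by apply: measurable_preimage_setT; [exact: measurable_mxD|exact: measurable_eball].
  apply/seteqP; split => [x [y yr <-]|x xr]; first by rewrite /= addrAC subrr add0r.
  by exists (x - pos j) => //; rewrite addrC subrK.
(* A common point forces the integers [j i] and [j' i] to differ by less than 1 for every [i]. *)
have Bdisj x j j' : x \in B j -> x \in B j' -> j = j'.
  move=> /set_mem/BE xj /set_mem/BE xj'; apply/ffunP => i; apply/val_inj/eqP.
  have := xj i; have := xj' i; rewrite !ltr_norml => /andP[h1 h2] /andP[h3 h4].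
  have h5 : 2 * r * (j i : nat)%:R < 2 * r * ((j' i : nat)%:R + 1) by lra.
  have h6 : 2 * r * (j' i : nat)%:R < 2 * r * ((j i : nat)%:R + 1) by lra.
  move: h5 h6; rewrite !ltr_pM2l ?mulr_gt0// !natr1 !ltr_nat !ltnS => h5 h6.
  by rewrite eqn_leq h5.
(* The sum of squares is at most the square of the sum, and the total count in the disjoint balls is
   at most the count in [Q]. *)
have NB w : \sum_j (npoints Lambda (B j) w) ^+ 2 <= (npoints Lambda Q w) ^+ 2.
  apply: le_trans (sum_sqr_le _) _; first by move=> j; exact: npoints_ge0.
  rewrite lerXn2r ?nnegrE ?sumr_ge0 ?npoints_ge0//; first by move=> j _; exact: npoints_ge0.
  rewrite (eq_bigr _ (fun j _ => npoints_sum lfL w bQ (BQ j))) exchange_big/=.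
  rewrite (npoints_sum lfL w bQ (@subset_refl _ Q)) !big_seq; apply: ler_sum => x.
  rewrite in_fset_set ?inE; last exact: lfL.
  move=> [_ Qx]; rewrite indicE mem_set//.
  by apply: (@sum_indic_le1 _ (fun j => x \in B j)); exact: Bdisj.
have mN2 (A : set 'rV[R]_d) : measurable A -> bounded_set A ->
    measurable_fun setT (fun w => ((npoints Lambda A w) ^+ 2)%:E).
  by move=> mA bA; apply/measurable_EFinP; apply: measurable_funX; exact: (pp_measurable ppL).
apply: (@le_trans _ _ (\int[P]_w (\sum_j (npoints Lambda (B j) w) ^+ 2)%:E)%E); last first.
  apply: ge0_le_integral => //.
  - by move=> w _; rewrite lee_fin sumr_ge0// => j _; rewrite sqr_ge0.
  - apply/measurable_EFinP; apply: measurable_sum => j; apply: measurable_funX.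
    exact: (pp_measurable ppL).
  - exact: mN2.
  - by move=> w _; rewrite lee_fin.
rewrite [leRHS](eq_integral (fun w => (\sum_j ((npoints Lambda (B j) w) ^+ 2)%:E)%E)); last first.
  by move=> w _; rewrite sumEFin.
rewrite ge0_integral_sum//; last 2 first.
- by move=> j; exact: mN2.
- by move=> j w _; rewrite lee_fin sqr_ge0.
rewrite (eq_bigr (fun=> \int[P]_w ((npoints Lambda (eball r) w) ^+ 2)%:E)%E); last first.
  move=> j _; apply: stationary_second_moment; last exact: bB.
    exact: measurable_eball.
  exact: bounded_eball.
rewrite -natrX mule_natl sumr_const card_ffun !card_ord; exact: lexx.
Qed.

End packing.

(** * Comparison of the two notions of hyperuniformity *)

Lemma variance_le_second_moment {R : realType} disp (T : measurableType disp)
    (P : probability T R) (X : T -> R) : measurable_fun setT X ->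
  (\int[P]_w ((X w) ^+ 2)%:E < +oo)%E ->
  ((fine 'V_P[X])%:E <= \int[P]_w ((X w) ^+ 2)%:E)%E.
Proof.
move=> mX X2.
have iX2 : P.-integrable setT (EFin \o (fun w => X w ^+ 2)).
  apply/integrableP; split; first by apply/measurable_EFinP; exact: measurable_funX.
  rewrite (eq_integral (fun w => (X w ^+ 2)%:E))// => w _.
  by rewrite /= ger0_norm// sqr_ge0.
have i1 (k : R) : P.-integrable setT (EFin \o (fun _ : T => k)).
  exact: finite_measure_integrable_cst.
have iX : P.-integrable setT (EFin \o X).
  apply: (@le_integrable _ _ _ P setT measurableT _ (EFin \o (fun w => 1 + X w ^+ 2))).
  - exact/measurable_EFinP.
  - move=> w _ /=; rewrite lee_fin [leRHS]ger0_norm ?addr_ge0 ?sqr_ge0//.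
    rewrite ler_norml; have := sqr_ge0 (X w - 1); have := sqr_ge0 (X w + 1).
    by rewrite !sqrrB !sqrrD; nra.
  - exact: (integrableD measurableT (i1 1) iX2).
set m := \int[P]_w X w.
have -> : fine 'V_P[X] = \int[P]_w ((X w - m) ^+ 2).
  rewrite /variance unlock unlock; congr fine.
have iZ : P.-integrable setT (EFin \o (fun w => (- 2 * m) * X w)).
  exact: (integrableZl measurableT _ iX).
have -> : \int[P]_w ((X w - m) ^+ 2) = \int[P]_w (X w ^+ 2) - m ^+ 2.
  transitivity (\int[P]_w (X w ^+ 2 + (- 2 * m * X w + m ^+ 2))).
    by apply: eq_Rintegral => w _; rewrite sqrrB; ring.
  rewrite RintegralD//; last first.
    exact: (integrableD measurableT iZ (i1 (m ^+ 2))).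
  rewrite RintegralD// RintegralZl// Rintegral_cst//.
  have -> : fine (P setT) = 1 by rewrite probability_setT.
  by rewrite -/m; ring.
rewrite -[leRHS]fineK; last first.
  by rewrite ge0_fin_numE// integral_ge0// => w _; rewrite lee_fin sqr_ge0.
by rewrite lee_fin gerBl sqr_ge0.
Qed.

(** * Bounds relating [v] and [nu]; the point process enters only through the integral formula
    [vE] *)

Section spectral_side.
Context {R : realType} {d : nat}.
Local Notation D := d.+1.
Context (nu : {measure set 'rV[R]_D -> \bar R}) (nu_radon : radon nu) (v : R -> R).
Let F (r : R) (xi : 'rV[R]_D) : R := sqnormc (fourier (@ball_indicator R D r) xi).
Context (vE : forall r, (nu.-integrable setT (fun xi => (F r xi)%:E) *
  (v r = \int[nu]_xi F r xi))%type).

Let nuB (s : R) : R := fine (nu (eball s)).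
Let nuBE s : nu (eball s) = (nuB s)%:E.
Proof.
rewrite fineK// ge0_fin_numE// radon_bounded_lty//; first exact: measurable_eball.
exact: bounded_eball.
Qed.
Let nuB_ge0 s : 0 <= nuB s. Proof. exact: fine_ge0. Qed.
Let nuB_le s t : s <= t -> nuB s <= nuB t.
Proof.
move=> st; rewrite -lee_fin -!nuBE; apply: le_measure; rewrite ?inE; try exact: measurable_eball.
by move=> x; rewrite !eballE /= => /lt_le_trans; exact.
Qed.
Let F_ge0 r xi : 0 <= F r xi. Proof. by rewrite /F /sqnormc addr_ge0 ?sqr_ge0. Qed.
Let v_ereal r : (v r)%:E = (\int[nu]_xi (F r xi)%:E)%E.
Proof. by rewrite (vE r).2 fineK// integrable_fin_num//; exact: (vE r).1. Qed.
Let mF r : measurable_fun setT (fun xi => (F r xi)%:E).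
Proof. exact: (measurable_int nu (vE r).1). Qed.

(* On [eball (2 pi r)^-1] the transform of the indicator of [eball r] is
   comparable to the volume of [eball r]. *)
Lemma variance_lb : exists2 c : R, 0 < c &
  forall r, 0 < r -> c * r ^+ D.*2 * nuB (2 * pi * r)^-1 <= v r.
Proof.
have [K [c [K0 c0 FB]]] := @fourier_ball_bounds R d.
exists c => // r r0; have mB := @measurable_eball R D (2 * pi * r)^-1.
have cr0 : 0 <= c * r ^+ D.*2 by rewrite mulr_ge0 ?exprn_ge0// ltW.
rewrite -lee_fin EFinM -nuBE v_ereal -integral_cst//.
apply: (@le_trans _ _ (\int[nu]_(xi in eball (2 * pi * r)^-1) (F r xi)%:E)%E).
  apply: ge0_le_integral => //.
  - exact: measurable_funS (mF r).
  - move=> xi; rewrite eballE /= => xir; rewrite lee_fin; have [+ _ _] := FB r xi r0; apply.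
    have pir : 0 < 2 * pi * r :> R by rewrite !mulr_gt0// pi_gt0.
    by rewrite mulrA -ler_pdivlMl// mulr1 ltW.
by apply: ge0_subset_integral => // xi _; rewrite lee_fin.
Qed.

(* The transform is bounded by a geometric series of indicators of the balls
   [eball (4^k / r)]; the decay leaves a spare factor [4^-k], one half of which
   makes the series converge while the other half absorbs the factor [2^k] in the
   hypothesis. *)
Lemma variance_ub : exists2 K : R, 0 < K &
  forall r b, 0 < r -> 0 <= b ->
  (forall k : nat, nuB (4 ^+ k / r) <= 2 ^+ k * b * (4 ^+ k / r) ^+ D) ->
  v r <= K * b * r ^+ D.
Proof.
have [K [c [K0 c0 FB]]] := @fourier_ball_bounds R d.
(* On the shell [4^(k-1) <= r |xi|], replacing [r |xi|] by [4^k] in the decay bound costs the factor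
   [4^(D+1)]. *)
pose K' := K * 4 ^+ D.+1.
have K'0 : 0 < K' by rewrite mulr_gt0// exprn_gt0.
exists (2 * K'); first by rewrite mulr_gt0.
move=> r b r0 b0 nuk.
pose a (k : nat) : R := K' * r ^+ D.*2 / (4 ^+ k) ^+ D.+1.
have a0 k : 0 <= a k.
  by rewrite ltW// divr_gt0 ?exprn_gt0// mulr_gt0// exprn_gt0.
pose g (k : nat) (xi : 'rV[R]_D) : \bar R := (a k * \1_(eball (4 ^+ k / r)) xi)%:E.
have g0 k xi : (0 <= g k xi)%E by rewrite lee_fin mulr_ge0.
have mg k : measurable_fun setT (g k).
  apply/measurable_EFinP; apply: measurable_funM => //.
  by apply: measurable_indic; exact: measurable_eball.
have Fg xi : ((F r xi)%:E <= \sum_(k <oo) g k xi)%E.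
  have ge_term k : (g k xi <= \sum_(i <oo) g i xi)%E.
    apply: le_trans (nneseries_lim_ge k.+1 _) => //.
    by rewrite big_nat_recr//= leeDr// sume_ge0.
  have [_ F1 F2] := FB r xi r0.
  have gE k : r * enorm xi < 4 ^+ k -> g k xi = (a k)%:E.
    move=> xik; by rewrite /g indic_eball ltr_pdivlMr// (mulrC (enorm xi)) xik mulr1.
  have ex_k : exists k : nat, r * enorm xi < 4 ^+ k.
    exists (Num.truncn (r * enorm xi)).+1.
    apply: (lt_le_trans (truncnS_gt _)).
    rewrite -natrX ler_nat; apply/ltnW; exact: ltn_expl.
  (* Take the least [k] with [r |xi| < 4^k]. For [k = 0] the uniform bound is used; otherwise
     minimality bounds [r |xi|] from below and the decay applies. *)
  case: (ex_minnP ex_k) => -[|k] xik kmin.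
    apply: le_trans (ge_term 0%N); rewrite gE// lee_fin.
    apply: (le_trans F1); rewrite /a expr0 expr1n divr1 ler_wpM2r ?exprn_ge0 ?(ltW r0)//.
    by rewrite /K' ler_peMr ?(ltW K0)// exprn_ege1// ler1n.
  apply: le_trans (ge_term k.+1); rewrite gE// lee_fin.
  have kxi : 4 ^+ k <= r * enorm xi.
    by rewrite leNgt; apply/negP => /kmin; rewrite ltnn.
  rewrite /a /K' ler_pdivlMr ?exprn_gt0//.
  rewrite [4 ^+ k.+1]exprS exprMn mulrCA [K * _ * _]mulrAC [leRHS]mulrC.
  rewrite ler_wpM2l ?exprn_ge0//.
  apply: le_trans F2; rewrite mulrC ler_wpM2r// lerXn2r ?nnegrE ?exprn_ge0//.
  by rewrite mulr_ge0 ?enorm_ge0// ltW.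
rewrite -lee_fin v_ereal.
apply: (@le_trans _ _ (\int[nu]_xi \sum_(k <oo) g k xi)%E).
  apply: ge0_le_integral => //.
  - by move=> xi _; rewrite lee_fin.
  - by apply: (@ge0_emeasurable_sum _ _ _ setT g xpredT) => [k xi _ _|k _]; [exact: g0|exact: mg].
rewrite integral_nneseries//.
(* The [k]-th integral is at most [K' b r^D 2^k / 4^k = 2 K' b r^D / 2^(k+1)], and [epsilon_trick0]
   sums these bounds. *)
apply: (@le_trans _ _ (\sum_(k <oo) ((2 * K' * b * r ^+ D) / (2 ^ k.+1)%:R)%:E)%E); last first.
  apply: epsilon_trick0; apply: mulr_ge0; last by rewrite exprn_ge0// ltW.
  by rewrite mulr_ge0// mulr_ge0// ltW.
apply: lee_nneseries => [k _ _|k _ ]; first by apply: integral_ge0 => xi _; exact: g0.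
have -> : (\int[nu]_xi g k xi = (a k * nuB (4 ^+ k / r))%:E)%E.
  rewrite EFinM -nuBE.
  have mB := @measurable_eball R D (4 ^+ k / r).
  have := @integral_indic _ _ _ nu _ measurableT _ mB; rewrite setIT => <-.
  rewrite -ge0_integralZl// ?lee_fin//.
  by apply/measurable_EFinP; exact: measurable_indic.
rewrite lee_fin; apply: (le_trans (ler_wpM2l (a0 k) (nuk k))).
rewrite le_eqVlt; apply/orP; left; apply/eqP.
have k4 : (4 : R) ^+ k = 2 ^+ k * 2 ^+ k by rewrite -exprMn -natrM.
have n2 : (2 : R) ^+ k != 0 by rewrite expf_neq0.
have r2D : r ^+ D.*2 = r ^+ D * r ^+ D by rewrite -addnn exprD.
have q0 : ((4 : R) ^+ k) ^+ D != 0 by rewrite !expf_neq0.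
have y0 : r ^+ D != 0 by rewrite expf_neq0// gt_eqF.
rewrite /a natrX (exprS _ k) (exprS _ D) expr_div_n r2D.
move: ((4 ^+ k) ^+ D) (r ^+ D) q0 y0 => q y q0 y0.
by rewrite k4; field; rewrite q0 y0 n2.
Qed.

(** For [r = 1 / (2 m)], [variance_lb] concerns the ball of radius [m / pi], so the bound on
    variances of small balls controls the growth of [nu] on large ones. *)
Lemma large_ball_bound (C s0 : R) : 0 <= C -> 0 < s0 ->
  (forall m : nat, (0 < m)%N -> m%:R ^+ D * v (2 * m%:R)^-1 <= C) ->
  exists2 K : R, 0 < K & forall s, s0 <= s -> nuB s <= K * s ^+ D.
Proof.
move=> C0 s00 vC; have [c c0 vlb] := variance_lb.
have p0 : 0 < pi :> R := pi_gt0 R.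
pose K := C / c * 4 ^+ D * (pi + s0^-1) ^+ D.
have pD : 0 < pi + s0^-1 by rewrite addr_gt0 ?invr_gt0.
have K0 : 0 <= K.
  apply: mulr_ge0; last by rewrite exprn_ge0// ltW.
  by rewrite mulr_ge0 ?exprn_ge0// divr_ge0// ltW.
exists (K + 1); first by rewrite ltr_wpDl.
(* Then [s <= m / pi], while [m <= pi * s + 1 <= (pi + s0^-1) * s] because [s >= s0]. *)
move=> s s0s; pose m := (Num.truncn (pi * s)).+1.
have sp : 0 < s by exact: lt_le_trans s0s.
have m0 : 0 < m%:R :> R by rewrite ltr0n.
have sm : s <= m%:R / pi.
  by rewrite ler_pdivlMr// mulrC ltW// truncnS_gt.
have ms : m%:R <= (pi + s0^-1) * s.
  rewrite /m -natr1 [leRHS]mulrDl lerD//.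
    by rewrite truncn_le// mulr_ge0// ltW.
  by rewrite mulrC ler_pdivlMr// mul1r.
apply: (le_trans (nuB_le sm)).
have rm0 : 0 < (2 * m%:R)^-1 :> R by rewrite invr_gt0 mulr_gt0.
have := vlb _ rm0; have := vC m isT.
have -> : (2 * pi * (2 * m%:R)^-1)^-1 = m%:R / pi :> R.
  have mn0 : m%:R != 0 :> R by rewrite gt_eqF.
  have pn0 : pi != 0 :> R by rewrite gt_eqF.
  by move: (m%:R : R) (pi : R) mn0 pn0 => x y x0 y0; field; rewrite ?x0 ?y0.
set n := nuB _ => h1 h2.
have n_ub : n <= C / c * 4 ^+ D * m%:R ^+ D.
  have mD : 0 < m%:R ^+ D :> R by rewrite exprn_gt0.
  have : m%:R ^+ D * (c * (2 * m%:R)^-1 ^+ D.*2 * n) <= C.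
    by apply: le_trans h1; rewrite ler_wpM2l// ltW.
  have e2 : (2 : R) ^+ D.*2 = 4 ^+ D by rewrite -mul2n exprM -natrX.
  have -> : m%:R ^+ D * (c * (2 * m%:R)^-1 ^+ D.*2 * n) = n * (c / (4 ^+ D * m%:R ^+ D)).
    rewrite exprVn exprMn e2 -[in m%:R ^+ D.*2]addnn exprD.
    have : (4 : R) ^+ D != 0 by rewrite expf_neq0.
    by move: (m%:R ^+ D) mD => x /gt_eqF/negbT x0 ?; field; rewrite x0.
  have q0 : 0 < c / (4 ^+ D * m%:R ^+ D) by rewrite divr_gt0// mulr_gt0// exprn_gt0.
  rewrite -ler_pdivlMr// => /le_trans; apply.
  rewrite invf_div le_eqVlt; apply/orP; left; apply/eqP.
  by move: (4 ^+ D) (m%:R ^+ D) c^-1 => x y z; ring.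
apply: (le_trans n_ub).
apply: (@le_trans _ _ (K * s ^+ D)).
  rewrite /K -!mulrA ler_wpM2l// ler_wpM2l ?invr_ge0 ?(ltW c0)// ler_wpM2l ?exprn_ge0//.
  rewrite -exprMn lerXn2r ?nnegrE ?(ltW m0)//.
  by rewrite mulr_ge0// ltW.
by rewrite ler_wpM2r ?exprn_ge0 ?(ltW sp)// lerDl.
Qed.

End spectral_side.

(** * The two implications, for normalized variances and normalized spectral mass *)

Section hyperuniformity.
Context {R : realType} {d : nat}.
Local Notation D := d.+1.
Local Notation vol r := (fine (lebesgue_rV D (@eball R D r))).
Context (nu : {measure set 'rV[R]_D -> \bar R}) (nu_radon : radon nu) (v : R -> R).
Let F (r : R) (xi : 'rV[R]_D) : R := sqnormc (fourier (@ball_indicator R D r) xi).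
Context (vE : forall r, (nu.-integrable setT (fun xi => (F r xi)%:E) *
  (v r = \int[nu]_xi F r xi))%type).

Let V : R := eball_volume D.
Let V0 : 0 < V. Proof. exact: eball_volume_gt0. Qed.
Let volE r : 0 < r -> vol r = r ^+ D * V.
Proof. by move=> r0; rewrite lebesgue_rV_eball// eball_volumeE. Qed.
Let v_ge0 r : 0 <= v r.
Proof.
by rewrite (vE r).2; apply: Rintegral_ge0 => xi _; rewrite /F /sqnormc addr_ge0 ?sqr_ge0.
Qed.

Lemma spectral_of_geometric :
  v r / vol r @[r --> +oo] --> 0 -> fine (nu (eball e)) / vol e @[e --> 0^'+] --> 0.
Proof.
move=> vlim; have [c c0 vlb] := variance_lb nu_radon vE.
have p0 : 0 < 2 * pi :> R by rewrite mulr_gt0// pi_gt0.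
(* With [e = 1 / (2 pi r)], [variance_lb] reads [nu (B_e) / vol e <= k * (v r / vol r)]. *)
pose k := (2 * pi) ^+ D / c.
have k0 : 0 < k by rewrite divr_gt0 ?exprn_gt0.
apply/cvgrPdist_le => eps eps0.
move/cvgrPdist_le : vlim => /(_ (eps / k)); rewrite divr_gt0// => /(_ isT)[A [_ HA]].
(* The threshold [A] may be nonpositive; [A'] can be inverted. *)
pose A' := Num.max A 1.
have A'0 : 0 < A' by rewrite lt_max ltr01 orbT.
near=> e.
have eA : e < (2 * pi * A')^-1 by near: e; apply: nbhs_right_lt; rewrite invr_gt0 mulr_gt0.
pose r := (2 * pi * e)^-1.
have r0 : 0 < r by rewrite invr_gt0 mulr_gt0.
have er : e = (2 * pi * r)^-1.
  by rewrite /r invfM invrK mulrA mulVf ?gt_eqF// mul1r.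
have A'r : A' < r.
  have pA' : 0 < 2 * pi * A' by exact: mulr_gt0.
  have pr : 0 < 2 * pi * r by exact: mulr_gt0.
  by rewrite -(ltr_pM2l p0) -ltf_pV2 ?posrE// -er.
have Ar : A < r by apply: le_lt_trans A'r; rewrite le_max lexx.
have := HA r Ar; rewrite sub0r normrN ger0_norm; last by rewrite divr_ge0// fine_ge0.
rewrite sub0r normrN ger0_norm; last by rewrite divr_ge0// fine_ge0.
rewrite !volE// !ler_pdivrMr ?mulr_gt0 ?exprn_gt0// => vr.
have := vlb r r0; rewrite -er => /le_trans/(_ vr).
have rD : 0 < r ^+ D by rewrite exprn_gt0.
have eD : e ^+ D = ((2 * pi) ^+ D * r ^+ D)^-1 by rewrite {1}er exprVn exprMn.
have pD : 0 < (2 * pi : R) ^+ D by rewrite exprn_gt0.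
rewrite eD -addnn exprD /k.
move: (r ^+ D) ((2 * pi) ^+ D) rD pD => x y x0 y0 h.
have cx0 : 0 < c * x * x by rewrite !mulr_gt0.
rewrite -(ler_pM2l cx0) -[c * x * x]mulrA; apply: le_trans h _.
rewrite le_eqVlt; apply/orP; left; apply/eqP.
by field; rewrite !gt_eqF.
Unshelve. all: by end_near. Qed.

Context (small_balls : exists2 C : R, 0 <= C &
  forall m : nat, (0 < m)%N -> m%:R ^+ D * v (2 * m%:R)^-1 <= C).

(** The hypothesis of [variance_ub] is checked for every radius [s = 4^k / r]: the spectral limit
    covers [s < del], and [large_ball_bound] covers the others, where [2^k] absorbs the constant [L]
    once [r] is large. *)
Lemma geometric_of_spectral :
  fine (nu (eball e)) / vol e @[e --> 0^'+] --> 0 -> v r / vol r @[r --> +oo] --> 0.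
Proof.
move=> nulim; have [K K0 vub] := variance_ub nu_radon vE.
have [C C0 vC] := small_balls.
apply/cvgrPdist_le => eps eps0.
(* Chosen so that [K * (eps1 * (V + 1)) = eps * V]. The factor [V + 1] dominates both [V], needed
   for small [s], and 1, needed for large [s]. *)
pose eps1 := eps * V / (K * (V + 1)).
have V1 : 0 < V + 1 by rewrite addr_gt0.
have eps10 : 0 < eps1.
  by apply: divr_gt0; [exact: mulr_gt0|exact: mulr_gt0].
move/cvgrPdist_le : nulim => /(_ _ eps10)[del /= del0 Hdel].
have [L L0 nuL] := large_ball_bound nu_radon vE C0 del0 vC.
(* If [r > R0] and [4^k / r >= del], then [4^k >= (L / eps1)^2], that is [2^k >= L / eps1]. *)
pose R0 := (L / eps1) ^+ 2 / del.
have R00 : 0 < R0.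
  by apply: divr_gt0 => //; apply: exprn_gt0; exact: divr_gt0.
near=> r.
have rR0 : R0 < r by near: r; apply: nbhs_pinfty_gt; exact: num_real.
have r0 : 0 < r by exact: lt_trans rR0.
rewrite sub0r normrN ger0_norm; last by rewrite divr_ge0// fine_ge0.
rewrite volE// ler_pdivrMr ?mulr_gt0 ?exprn_gt0//.
have b0 : 0 <= eps1 * (V + 1) by rewrite mulr_ge0// ltW.
have := vub r (eps1 * (V + 1)) r0 b0 => vr.
apply: le_trans (vr _) _; last first.
  rewrite le_eqVlt; apply/orP; left; apply/eqP; rewrite /eps1.
  by move: (r ^+ D) => x; field; rewrite !gt_eqF.
move=> k; set s := 4 ^+ k / r.
have s0 : 0 < s by rewrite divr_gt0// exprn_gt0.
have k1 : 1 <= 2 ^+ k :> R by rewrite exprn_ege1// ler1n.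
have [sd|sd] := ltP s del.
  have := Hdel s; rewrite /ball_/= sub0r normrN gtr0_norm// => /(_ sd s0).
  rewrite sub0r normrN ger0_norm; last by rewrite divr_ge0// fine_ge0.
  rewrite volE// ler_pdivrMr ?mulr_gt0 ?exprn_gt0// => /le_trans; apply.
  rewrite [s ^+ D * V]mulrC mulrA ler_wpM2r ?exprn_ge0 ?(ltW s0)//.
  apply: (@le_trans _ _ (eps1 * (V + 1))).
    by rewrite ler_wpM2l ?(ltW eps10)// lerDl.
  by rewrite ler_peMl.
apply: (le_trans (nuL s sd)); rewrite ler_wpM2r ?exprn_ge0 ?(ltW s0)//.
have Lk : L <= 2 ^+ k * eps1.
  have q0 : 0 <= L / eps1 by rewrite ltW// divr_gt0.
  rewrite -ler_pdivrMr//; suff : (L / eps1) ^+ 2 <= (2 ^+ k) ^+ 2.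
    by rewrite ler_pXn2r ?nnegrE// exprn_ge0.
  rewrite -exprM mulnC exprM -natrX.
  have dr : del * r <= 4 ^+ k by rewrite -ler_pdivlMr.
  by apply: le_trans dr; rewrite (mulrC del) -ler_pdivrMr// ltW.
apply: (le_trans Lk); apply: ler_wpM2l; first by rewrite exprn_ge0.
by apply: ler_peMr; [exact: ltW|rewrite lerDr ltW].
Unshelve. all: by end_near. Qed.

End hyperuniformity.

Theorem theorem1p1 (R : realType) (d : nat) (disp : measure_display)
    (Omega : measurableType disp) (P : probability Omega R)
    (T : 'rV[R]_d -> Omega -> Omega) (Lambda : Omega -> set 'rV[R]_d)
    (etahat : {measure set 'rV[R]_d -> \bar R}) :
  (1 <= d)%N ->
  standard_borel R Omega ->
  pmp_action P T ->
  invariant_point_process T Lambda ->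
  locally_square_integrable P Lambda ->
  is_centered_diffraction P Lambda etahat ->
  geometrically_hyperuniform P Lambda <-> spectrally_hyperuniform etahat.
Proof.
case: d T Lambda etahat => // d T Lambda etahat _ _ aT ppL sqL [eta [etaL [etahat_radon eta_ft]]].
have lfL := pp_locally_finite ppL.
pose v r := fine 'V_P[npoints Lambda (eball r)].
pose F (r : R) (xi : 'rV[R]_d.+1) : R := sqnormc (fourier (@ball_indicator R d.+1 r) xi).
(* Both defining identities evaluate [eta] on the same convolution built from [ball_indicator r], so
   [eta] is eliminated between them. *)
have vE r : (etahat.-integrable setT (fun xi => (F r xi)%:E) * (v r = \int[etahat]_xi F r xi))%type.
  have tf := @test_function_ball_indicator R d.+1 r.
  have [iF eF] := eta_ft _ tf; split => //.
  by move: eF; rewrite (etaL _ tf) cvariance_ball// => -[].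
have small_balls : exists2 C : R, 0 <= C &
    forall m : nat, (0 < m)%N -> m%:R ^+ d.+1 * v (2 * m%:R)^-1 <= C.
  have [C C0 HC] := small_ball_second_moment aT ppL sqL.
  exists C => // m m0; rewrite -lee_fin; apply: le_trans (HC m m0).
  rewrite EFinM lee_wpmul2l ?lee_fin ?exprn_ge0//.
  apply: variance_le_second_moment.
    by apply: (pp_measurable ppL); [exact: measurable_eball|exact: bounded_eball].
  by apply: sqL; [exact: measurable_eball|exact: bounded_eball].
split.
  exact: (spectral_of_geometric etahat_radon vE).
exact: (geometric_of_spectral etahat_radon vE small_balls).
Qed.
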